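(* (i) For any $\mathbf{u}\in T^3$ the complex unital $*$-algebra $\mathcal{A}_{\mathbf{u}}$ satisfies conditions (I) and (II). Moreover, if $\mathcal{A}$ is a complex unital $*$-algebra satisfying conditions (I) and (II), then $\mathcal{A}$ is a quotient of $\mathcal{A}_{\mathbf{u}}$ (i.e. a homomorphic image of $\mathcal{A}_{\mathbf{u}}$ as unital $*$-algebra) for some $\mathbf{u}\in T^3$. (ii) For any $\mathbf{u}\in T^3$ the complex unital $*$-algebra $\mathcal{A}^{(1)}_{\mathbf{u}}$ satisfies conditions (I$_1$) and (II). Moreover, if $\mathcal{A}^{(1)}$ is a complex unital $*$-algebra satisfying conditions (I$_1$) and (II), then $\mathcal{A}^{(1)}$ is a quotient of $\mathcal{A}^{(1)}_{\mathbf{u}}$ for some $\mathbf{u}\in T^3$.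
   Context: Conditions. A complex unital $*$-algebra $\mathcal{A}$ satisfies (I) and (II) if there is $U=(U^i_j)\in M_2(\mathcal{A})=M_2(\mathbb{C})\otimes\mathcal{A}$ such that: (I) $\mathcal{A}$ is generated as unital $*$-algebra by the matrix elements $U^i_j$ of $U$, and $U^*U=UU^*\in \mathbf{1}_2\otimes\mathcal{A}$, where $\mathbf 1_2$ is the unit of $M_2(\mathbb{C})$; (II) $\sum_{i,j}\big(U^i_j\otimes (U^* )^j_i-(U^* )^i_j\otimes U^j_i\big)=0$ in $\mathcal{A}\otimes\mathcal{A}$. It satisfies (I$_1$) and (II) if there is $U\in M_2(\mathcal{A})$ satisfying (II) and (I$_1$) $U$ is unitary ($U^*U=UU^*=\mathbf 1$) and $\mathcal{A}$ is generated as unital $*$-algebra by the matrix elements of $U$. Algebras. For $\mathbf{u}=(e^{i\varphi_1},e^{i\varphi_2},e^{i\varphi_3})\in T^3$ ($\varphi_k\in\mathbb{R}$), $\mathcal{A}_{\mathbf{u}}$ is the complex unital $*$-algebra generated by four hermitian elements $x^0,x^1,x^2,x^3$ with the relations $$\cos(\varphi_k)[x^0,x^k]_-=i\sin(\varphi_\ell-\varphi_m)[x^\ell,x^m]_+,\qquad \cos(\varphi_\ell-\varphi_m)[x^\ell,x^m]_-=-i\sin(\varphi_k)[x^0,x^k]_+$$ for $k=1,2,3$, where $(k,\ell,m)$ is the cyclic permutation of $(1,2,3)$ starting with $k$ and $[x,y]_\pm=xy\pm yx$. The algebra $\mathcal{A}^{(1)}_{\mathbf{u}}$ is the quotient of $\mathcal{A}_{\mathbf{u}}$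 by the two-sided ideal generated by $\sum_{\mu=0}^3(x^\mu)^2-\mathbf 1$. *)

(* Defs.v *)
From HB Require Import structures.
From mathcomp Require Import all_boot all_order all_algebra.
From mathcomp Require Import complex boolp classical_sets reals trigo.
From mathcomp Require Import finmap monalg.

Set Implicit Arguments.
Unset Strict Implicit.
Unset Printing Implicit Defensive.

Import Order.TTheory GRing.Theory Num.Theory.
Local Open Scope ring_scope.
Local Open Scope classical_set_scope.
Local Open Scope quotient_scope.

(* The ring structure is only a pzRingType, so that the zero algebra is not
   excluded; as MathComp has no join of pzRingType and lmodType, the scaling is
   part of the mixin and provides the lmodType structure afterwards. *)
HB.mixin Record isStarAlgebra (C : numClosedFieldType) A of GRing.PzRing A := {
  sscale : C -> A -> A;
  sscaleA : forall a b x, sscale a (sscale b x) = sscale (a * b) x;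
  sscale1 : left_id 1 sscale;
  sscaleDr : right_distributive sscale +%R;
  sscaleDl : forall x, {morph sscale^~ x : a b / a + b};
  sscaleAl : forall c (x y : A), sscale c (x * y) = sscale c x * y;
  sscaleAr : forall c (x y : A), sscale c (x * y) = x * sscale c y;
  star : A -> A;
  starK : involutive star;
  starD : {morph star : x y / x + y};
  star_sscale : forall c x, star (sscale c x) = sscale c^* (star x);
  starM : forall x y : A, star (x * y) = star y * star x
}.

#[short(type="starAlgType")]
HB.structure Definition StarAlgebra (C : numClosedFieldType) :=
  {A of GRing.PzRing A & isStarAlgebra C A}.

Section StarAlgebraLmodule.
Variables (C : numClosedFieldType) (A : starAlgType C).

#[non_forgetful_inheritance]
HB.instance Definition _ := GRing.Zmodule_isLmodule.Build C (StarAlgebra.sort A)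
  (@sscaleA C A) (@sscale1 C A) (@sscaleDr C A) (@sscaleDl C A).

Lemma star_scalerAl (c : C) (x y : A) : c *: (x * y) = (c *: x) * y.
Proof. exact: sscaleAl. Qed.

Lemma star_scalerAr (c : C) (x y : A) : c *: (x * y) = x * (c *: y).
Proof. exact: sscaleAr. Qed.

Lemma starZ (c : C) (x : A) : star (c *: x) = c^* *: star x.
Proof. exact: star_sscale. Qed.

End StarAlgebraLmodule.

Section StarAlgebraNotions.
Variable C : numClosedFieldType.

Definition star_subalgebra (A : starAlgType C) (P : set A) : Prop :=
  [/\ P 1,
      forall (c : C) x y, P x -> P y -> P (c *: x + y),
      forall x y, P x -> P y -> P (x * y)
    & forall x, P x -> P (star x)].

Definition star_generated (A : starAlgType C) (S : set A) : Prop :=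
  forall P : set A, star_subalgebra P -> S `<=` P -> forall x, P x.

(* {lrmorphism A -> B} is not available as A and B may be zero. *)
Definition star_morphism (A B : starAlgType C) (f : A -> B) : Prop :=
  [/\ linear f, monoid_morphism f & forall x, f (star x) = star (f x)].

Definition is_star_quotient_of (B A : starAlgType C) : Prop :=
  exists2 f : A -> B, star_morphism f & forall y, exists x, f x = y.

End StarAlgebraNotions.

Section Span.
Variables (C : numClosedFieldType) (V : lmodType C) (S : set V).

Definition span : {pred V} := fun v =>
  `[< exists n (c : 'I_n -> C) (s : 'I_n -> V),
        (forall i, S (s i)) /\ v = \sum_i c i *: s i >].

Lemma spanP v : reflect (exists n (c : 'I_n -> C) (s : 'I_n -> V),
  (forall i, S (s i)) /\ v = \sum_i c i *: s i) (v \in span).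
Proof. exact: asboolP. Qed.

Lemma span_gen v : S v -> v \in span.
Proof.
move=> Sv; apply/spanP; exists 1%N, (fun=> 1), (fun=> v); split=> //.
by rewrite big_ord1 scale1r.
Qed.

Lemma span0 : 0 \in span.
Proof.
by apply/spanP; exists 0%N, (fun=> 0), (fun=> 0); split; [case | rewrite big_ord0].
Qed.

Lemma spanD : {in span &, forall x y, x + y \in span}.
Proof.
move=> x y /spanP[n [c [s [Ss ->]]]] /spanP[m [d [t [St ->]]]].
apply/spanP; exists (n + m)%N.
exists (fun i => match fintype.split i with inl j => c j | inr j => d j end).
exists (fun i => match fintype.split i with inl j => s j | inr j => t j end).
split; first by move=> i; case: (fintype.split i).
rewrite big_split_ord /=; congr (_ + _); apply: eq_bigr => i _.
  by rewrite (unsplitK (inl i)).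
by rewrite (unsplitK (inr i)).
Qed.

Lemma spanZ a : {in span, forall x, a *: x \in span}.
Proof.
move=> x /spanP[n [c [s [Ss ->]]]]; apply/spanP; exists n, (fun i => a * c i), s.
by split=> //; rewrite scaler_sumr; apply: eq_bigr => i _; rewrite scalerA.
Qed.

Lemma span_zmod_closed : zmod_closed span.
Proof.
split=> [|x y xS yS]; first exact: span0.
by rewrite -scaleN1r; apply: spanD => //; apply: spanZ.
Qed.

HB.instance Definition _ := GRing.isZmodClosed.Build V span span_zmod_closed.

Lemma span_ind (P : V -> Prop) : P 0 -> (forall x y, P x -> P y -> P (x + y)) ->
  (forall c x, S x -> P (c *: x)) -> {in span, forall x, P x}.
Proof.
move=> P0 PD PZ x /spanP[n [c [s [Ss ->]]]].
by apply: (big_ind P) => // i _; apply: PZ.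
Qed.

End Span.

Section ModuleQuotient.
Variables (C : numClosedFieldType) (V : lmodType C) (S : set V).

Definition lquot := Quotient.quot (span S).
HB.instance Definition _ := GRing.Zmodule.on lquot.

Definition lproj (x : V) : lquot := \pi_(Quotient.quot (span S)) x.

Lemma lproj_surj q : exists x, lproj x = q.
Proof. by exists (repr (q : Quotient.quot (span S))); rewrite /lproj reprK. Qed.

Lemma lproj_eq x y : lproj x = lproj y <-> x - y \in span S.
Proof.
rewrite (Quotient.idealrBE (span S)); split=> [h|/eqP//].
by apply/eqP.
Qed.

Lemma lprojB : {morph lproj : x y / x - y}.
Proof. by move=> x y; rewrite /lproj raddfB. Qed.

Lemma lprojD : {morph lproj : x y / x + y}.
Proof. by move=> x y; rewrite /lproj raddfD. Qed.

Definition lquot_scale (c : C) (q : lquot) : lquot :=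
  lproj (c *: repr (q : Quotient.quot (span S))).

Lemma lquot_scaleE c x : lquot_scale c (lproj x) = lproj (c *: x).
Proof.
apply/lproj_eq; rewrite -scalerBr; apply: spanZ; apply/lproj_eq.
by rewrite /lproj reprK.
Qed.

Let scaleA a b q : lquot_scale a (lquot_scale b q) = lquot_scale (a * b) q.
Proof. by have [x <-] := lproj_surj q; rewrite !lquot_scaleE scalerA. Qed.
Let scale1 : left_id 1 lquot_scale.
Proof. by move=> q; have [x <-] := lproj_surj q; rewrite lquot_scaleE scale1r. Qed.
Let scaleDr : right_distributive lquot_scale +%R.
Proof.
move=> c q r; have [x <-] := lproj_surj q; have [y <-] := lproj_surj r.
by rewrite -lprojD !lquot_scaleE scalerDr lprojD.
Qed.
Let scaleDl q : {morph lquot_scale^~ q : a b / a + b}.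
Proof.
by move=> a b; have [x <-] := lproj_surj q; rewrite !lquot_scaleE scalerDl lprojD.
Qed.

HB.instance Definition _ :=
  GRing.Zmodule_isLmodule.Build C lquot scaleA scale1 scaleDr scaleDl.

Lemma lprojZ c : {morph lproj : x / c *: x}.
Proof. by move=> x; rewrite -lquot_scaleE. Qed.

End ModuleQuotient.

Section Tensor.
Variables (C : numClosedFieldType) (V W : lmodType C).

Let pure (v : V) (w : W) : {malg C[(V * W)%type]} := << (v, w) >>.

Definition bilinear_relations : set {malg C[(V * W)%type]} :=
  [set r | (exists c v v' w,
              r = pure (c *: v + v') w - (c *: pure v w + pure v' w)) \/
           (exists c v w w',
              r = pure v (c *: w + w') - (c *: pure v w + pure v w'))].

Definition tensor_product := lquot bilinear_relations.
HB.instance Definition _ := GRing.Lmodule.on tensor_product.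

Definition tensor (v : V) (w : W) : tensor_product :=
  lproj bilinear_relations (pure v w).

End Tensor.

Section StarAlgebraQuotient.
Variables (C : numClosedFieldType) (A : starAlgType C) (S : set A).

(* A relation s = 0 in a *-algebra entails star s = 0. For a set S stable under
   the involution up to sign, such as those used below, the span of
   ideal_gens is simply the two-sided ideal generated by S. *)
Definition ideal_gens : set A :=
  [set r | exists a s b, (S s \/ S (star s)) /\ r = a * s * b].

Definition star_quot := lquot ideal_gens.
HB.instance Definition _ := GRing.Lmodule.on star_quot.

Definition star_proj (x : A) : star_quot := lproj ideal_gens x.

Let I := span ideal_gens.

Let star0 : star (0 : A) = 0.
Proof. by apply: (addrI (star 0)); rewrite -starD !addr0. Qed.

Let starN (x : A) : star (- x) = - star x.
Proof. by rewrite -scaleN1r starZ rmorphN1 scaleN1r. Qed.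

Let idealMl (a : A) : {in I, forall x, a * x \in I}.
Proof.
apply: (span_ind (P := fun x : A => a * x \in I)) => [|x y|c _ [b [s [d [Ss ->]]]]].
- by rewrite mulr0 span0.
- by rewrite mulrDr; apply: spanD.
- rewrite -star_scalerAr; apply/spanZ/span_gen.
  by exists (a * b), s, d; rewrite !mulrA.
Qed.

Let idealMr (a : A) : {in I, forall x, x * a \in I}.
Proof.
apply: (span_ind (P := fun x : A => x * a \in I)) => [|x y|c _ [b [s [d [Ss ->]]]]].
- by rewrite mul0r span0.
- by rewrite mulrDl; apply: spanD.
- rewrite -star_scalerAl; apply/spanZ/span_gen.
  by exists b, s, (d * a); rewrite !mulrA.
Qed.

Let ideal_star : {in I, forall x, star x \in I}.
Proof.
apply: (span_ind (P := fun x : A => star x \in I)) => [|x y|c _ [b [s [d [Ss ->]]]]].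
- by rewrite star0 span0.
- by rewrite starD; apply: spanD.
- rewrite starZ; apply/spanZ/span_gen.
  exists (star d), (star s), (star b); rewrite starK; split; first by case: Ss; auto.
  by rewrite !starM mulrA.
Qed.

Let rp (q : star_quot) : A := repr (q : Quotient.quot I).
Let rpK q : star_proj (rp q) = q.
Proof. by rewrite /star_proj /lproj /rp reprK. Qed.
Let rpI x : rp (star_proj x) - x \in I.
Proof. by apply/lproj_eq; rewrite -[LHS]/(star_proj _) rpK. Qed.

Definition star_quot_mul (q r : star_quot) : star_quot := star_proj (rp q * rp r).
Definition star_quot_star (q : star_quot) : star_quot := star_proj (star (rp q)).

Let mulE x y : star_quot_mul (star_proj x) (star_proj y) = star_proj (x * y).
Proof.
apply/lproj_eq; set a := rp _; set b := rp _.
have -> : a * b - x * y = (a - x) * b + x * (b - y).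
  by rewrite mulrBl mulrBr addrA subrK.
by apply: spanD; [apply/idealMr/rpI | apply/idealMl/rpI].
Qed.

Let starE x : star_quot_star (star_proj x) = star_proj (star x).
Proof.
by apply/lproj_eq; rewrite -starN -starD; apply/ideal_star/rpI.
Qed.

Let sD x y : star_proj (x + y) = star_proj x + star_proj y.
Proof. exact: lprojD. Qed.
Let sZ c x : star_proj (c *: x) = c *: star_proj x.
Proof. exact: lprojZ. Qed.

Let one : star_quot := star_proj 1.
Let mulA : associative star_quot_mul.
Proof. by move=> q r s; rewrite -(rpK q) -(rpK r) -(rpK s) !mulE mulrA. Qed.
Let mul1 : left_id one star_quot_mul.
Proof. by move=> q; rewrite -(rpK q) mulE mul1r. Qed.
Let mulr1' : right_id one star_quot_mul.
Proof. by move=> q; rewrite -(rpK q) mulE mulr1. Qed.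
Let mulDl : left_distributive star_quot_mul +%R.
Proof. by move=> q r s; rewrite -(rpK q) -(rpK r) -(rpK s) -sD !mulE mulrDl sD. Qed.
Let mulDr : right_distributive star_quot_mul +%R.
Proof. by move=> q r s; rewrite -(rpK q) -(rpK r) -(rpK s) -sD !mulE mulrDr sD. Qed.

HB.instance Definition _ :=
  GRing.Zmodule_isPzRing.Build star_quot mulA mul1 mulr1' mulDl mulDr.

Let qscalerAl c (q r : star_quot) : c *: (q * r) = (c *: q) * r.
Proof.
rewrite -[q * r]/(star_quot_mul q r) -[_ * r]/(star_quot_mul _ r).
by rewrite -(rpK q) -(rpK r) -sZ !mulE -sZ star_scalerAl.
Qed.
Let qscalerAr c (q r : star_quot) : c *: (q * r) = q * (c *: r).
Proof.
rewrite -[q * r]/(star_quot_mul q r) -[q * _]/(star_quot_mul q _).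
by rewrite -(rpK q) -(rpK r) -sZ !mulE -sZ star_scalerAr.
Qed.
Let qstarK : involutive star_quot_star.
Proof. by move=> q; rewrite -(rpK q) !starE starK. Qed.
Let qstarD : {morph star_quot_star : q r / q + r}.
Proof. by move=> q r; rewrite -(rpK q) -(rpK r) -sD !starE starD sD. Qed.
Let qstarZ c (q : star_quot) : star_quot_star (c *: q) = c^* *: star_quot_star q.
Proof. by rewrite -(rpK q) -sZ !starE starZ sZ. Qed.
Let qstarM (q r : star_quot) :
  star_quot_star (q * r) = star_quot_star r * star_quot_star q.
Proof.
rewrite -[q * r]/(star_quot_mul q r) -[RHS]/(star_quot_mul _ _).
by rewrite -(rpK q) -(rpK r) mulE !starE mulE starM.
Qed.

HB.instance Definition _ := isStarAlgebra.Build C star_quot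
  (@scalerA C (lquot ideal_gens)) (@scale1r C (lquot ideal_gens))
  (@scalerDr C (lquot ideal_gens))
  (fun x a b => @scalerDl C (lquot ideal_gens) x a b) qscalerAl qscalerAr qstarK qstarD qstarZ qstarM.

Lemma star_proj_morphism : star_morphism star_proj.
Proof.
split=> [c x y||x]; first by rewrite sD sZ.
  by split=> // x y; rewrite -mulE.
by rewrite -starE.
Qed.

Lemma star_proj_surj q : exists x, star_proj x = q.
Proof. by exists (rp q); apply: rpK. Qed.

Lemma star_proj_eq x y : star_proj x = star_proj y <-> x - y \in span ideal_gens.
Proof. exact: lproj_eq. Qed.

End StarAlgebraQuotient.

Section FreeHermitian.
Variables (C : numClosedFieldType) (J : choiceType).

(* The free unital *-algebra on hermitian generators indexed by J: the free
   algebra, with the antilinear involution that reverses words. *)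
Definition free_herm := {malg C[{fmonom J}]}.
HB.instance Definition _ := GRing.NzRing.on free_herm.
HB.instance Definition _ := GRing.Lmodule.on free_herm.

Definition herm_gen (j : J) : free_herm := << fmu j >>.

Definition rev_word (w : {fmonom J}) : {fmonom J} := FMonom (rev w).

Definition free_star (f : free_herm) : free_herm :=
  \sum_(w <- msupp f) << (f@_w)^* *g rev_word w >>.

Let revK : involutive rev_word.
Proof. by case=> w; rewrite /rev_word revK. Qed.

Let revM v w : rev_word (mmul v w) = mmul (rev_word w) (rev_word v).
Proof. by apply: val_inj; rewrite /= !fmM /= rev_cat. Qed.

Let starC f w : (free_star f)@_w = (f@_(rev_word w))^*.
Proof.
rewrite raddf_sum /= (eq_bigr (fun v => (f@_v)^* *+ (v == rev_word w))); last first.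
  by move=> v _; rewrite mcoeffU (can2_eq revK revK).
have [wf|wf] := boolP (rev_word w \in msupp f).
  rewrite (big_fsetD1 _ wf) /= eqxx mulr1n big_seq big1 ?addr0 // => v.
  by rewrite in_fsetD1 => /andP[/negPf-> _].
rewrite (mcoeff_outdom wf) conjC0 big_seq big1 // => v vf.
by case: eqP => // vE; rewrite -vE vf in wf.
Qed.

Let starU c w : free_star << c *g w >> = << c^* *g rev_word w >>.
Proof.
apply/malgP => v; rewrite starC !mcoeffU (can2_eq revK revK).
by case: eqP; rewrite ?conjC0.
Qed.

Let fstarK : involutive free_star.
Proof. by move=> f; apply/malgP => w; rewrite !starC revK conjCK. Qed.

Let fstarD : {morph free_star : f g / f + g}.
Proof.
by move=> f g; apply/malgP => w; rewrite mcoeffD !starC mcoeffD rmorphD.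
Qed.

Let fstarZ (c : C) (f : free_herm) : free_star (c *: f) = c^* *: free_star f.
Proof. by apply/malgP => w; rewrite mcoeffZ !starC mcoeffZ rmorphM. Qed.

Let fstar0 : free_star 0 = 0.
Proof. by apply/malgP => w; rewrite starC !mcoeff0 conjC0. Qed.

Let fstar_sum (T : Type) (r : seq T) (F : T -> free_herm) :
  free_star (\sum_(i <- r) F i) = \sum_(i <- r) free_star (F i).
Proof. exact: (big_morph _ fstarD fstar0). Qed.

Let fstarM (f g : free_herm) : free_star (f * g) = free_star g * free_star f.
Proof.
rewrite [f * g]malgME fstar_sum [in RHS]/free_star mulr_suml.
under eq_bigr do rewrite fstar_sum.
rewrite exchange_big /=; apply: eq_bigr => v _.
rewrite mulr_sumr; apply: eq_bigr => w _.
by rewrite starU revM rmorphM malgM_def fgmulUU [_^* * _]mulrC.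
Qed.

Let fscalerAl (c : C) (f g : free_herm) : c *: (f * g) = (c *: f) * g.
Proof. exact: scalerAl. Qed.

Let fscalerAr (c : C) (f g : free_herm) : c *: (f * g) = f * (c *: g).
Proof.
rewrite -[LHS]fstarK fstarZ fstarM fscalerAl -fstarZ -fstarM.
by rewrite fstarK.
Qed.

HB.instance Definition _ := isStarAlgebra.Build C free_herm
  (@scalerA C free_herm) (@scale1r C free_herm) (@scalerDr C free_herm)
  (fun x a b => @scalerDl C free_herm x a b) fscalerAl fscalerAr fstarK fstarD fstarZ fstarM.

Lemma star_herm_gen j : star (herm_gen j) = herm_gen j.
Proof.
rewrite /star /= starU conjC1; congr << 1 *g _ >>.
by apply: val_inj; rewrite /= fmU.
Qed.

End FreeHermitian.

Section Spheres.
Variable R : realType.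

Definition expi (t : R) : R[i] := (cos t +i* sin t)%C.

Definition in_torus3 (u : 'I_3 -> R[i]) : Prop := forall k, `|u k| = 1.

Section Relations.
Variables (A : starAlgType R[i]) (x : 'I_4 -> A).

Definition comm (a b : A) := a * b - b * a.
Definition acomm (a b : A) := a * b + b * a.

(* phi_1, phi_2, phi_3 are phi 0, phi 1, phi 2, and x^k is x (lift ord0 k);
   ordS is the successor modulo 3. *)
Definition relation_0k (phi : 'I_3 -> R) (k : 'I_3) : A :=
  let l := ordS k in let m := ordS l in
  let xs (j : 'I_3) := x (lift ord0 j) in
  (cos (phi k))%:C%C *: comm (x ord0) (xs k)
  - ('i%C * (sin (phi l - phi m))%:C%C) *: acomm (xs l) (xs m).

Definition relation_lm (phi : 'I_3 -> R) (k : 'I_3) : A :=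
  let l := ordS k in let m := ordS l in
  let xs (j : 'I_3) := x (lift ord0 j) in
  (cos (phi l - phi m))%:C%C *: comm (xs l) (xs m)
  - (- 'i%C * (sin (phi k))%:C%C) *: acomm (x ord0) (xs k).

(* All lifts phi of u yield the same relations; quantifying over them makes
   the set a function of u without choosing angles. *)
Definition relations (u : 'I_3 -> R[i]) : set A :=
  [set r | exists2 phi : 'I_3 -> R, forall k, u k = expi (phi k) &
           exists k, r = relation_0k phi k \/ r = relation_lm phi k].

End Relations.

Section Algebras.
Variable u : 'I_3 -> R[i].

Definition Au : starAlgType R[i] :=
  star_quot (relations (@herm_gen R[i] 'I_4) u).

Definition Au_gen (mu : 'I_4) : Au := star_proj _ (herm_gen _ mu).

Definition Au1 : starAlgType R[i] :=
  star_quot [set \sum_(mu < 4) Au_gen mu ^+ 2 - 1].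

End Algebras.

Section Conditions.
Variable A : starAlgType R[i].
Implicit Type U : 'M[A]_2.

(* U i j is U^i_j, the upper index being the row. *)
Definition adjoint U : 'M[A]_2 := \matrix_(i, j) star (U j i).

Definition entries U : set A := [set a | exists i j, a = U i j].

Definition condI U : Prop :=
  star_generated (entries U) /\
  exists a : A, adjoint U *m U = a%:M /\ U *m adjoint U = a%:M.

Definition condI1 U : Prop :=
  (adjoint U *m U = 1%:M /\ U *m adjoint U = 1%:M) /\ star_generated (entries U).

Definition condII U : Prop :=
  \sum_i \sum_j (tensor (U i j) (adjoint U j i) - tensor (adjoint U i j) (U j i))
    = 0 :> tensor_product A A.

Definition satisfies_I_II : Prop := exists U, condI U /\ condII U.
Definition satisfies_I1_II : Prop := exists U, condI1 U /\ condII U.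

End Conditions.

End Spheres.

(* Main.v *)
(* Write U = sum_mu tau_mu (x) z_mu with tau_0 = 1 and tau_k = i sigma_k. Since
   the tau_mu are orthogonal for the trace form, (II) says that the tensor
   sum_mu z_mu (x) z_mu^* is symmetric; this property is invariant under real
   orthogonal changes of z. An inductive diagonalization provides a real
   orthogonal O such that each component of O z is a phase times a hermitian
   element: z = a + i b with a, b hermitian, and symmetry of the tensor makes b
   a real symmetric matrix applied to a when the a_mu are independent.

   The rows of O are orthonormal quaternions T_mu, and T_0^* T_k is, up to a
   common sign, another triple S_k satisfying the relations of the i sigma_k.
   So, up to left multiplication by a scalar unitary matrix, U is
   M = 1 (x) x^0 + sum_k S_k (x) u_k x^k with x^mu hermitian and |u_k| = 1.
   The coefficients of S_k in M M^* and M^* M are the difference and the sum of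
   the two relations of index k, and both coefficients of 1 are
   sum_mu (x^mu)^2. Hence (I) is equivalent to the relations, and (I_1) to the
   relations together with sum_mu (x^mu)^2 = 1. *)
From HB Require Import structures.
Require Import Defs.
From mathcomp Require Import all_boot all_order all_algebra.
From mathcomp Require Import complex boolp classical_sets reals trigo.
From mathcomp Require Import finmap monalg spectral sesquilinear ssrAC ring.

Set Implicit Arguments.
Unset Strict Implicit.
Unset Printing Implicit Defensive.

Import Order.TTheory GRing.Theory Num.Theory.
Local Open Scope ring_scope.
Local Open Scope classical_set_scope.

Local Notation realmx := (mxOver Num.real).

(** * Universal properties *)

Section MalgExtension.
Variables (C : numClosedFieldType) (K : choiceType) (X : lmodType C).
Variable h : K -> X.

Definition malg_extend (g : {malg C[K]}) : X := \sum_(k <- msupp g) g@_k *: h k.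

Lemma malg_extendEw (d : {fset K}) g : (msupp g `<=` d)%fset ->
  malg_extend g = \sum_(k <- d) g@_k *: h k.
Proof.
move=> le; rewrite /malg_extend (big_fset_incl _ le) // => k _ /mcoeff_outdom ->.
by rewrite scale0r.
Qed.

Lemma malg_extend_is_linear : linear malg_extend.
Proof.
move=> c f g; pose d := (msupp f `|` msupp g)%fset.
rewrite (@malg_extendEw d) ?(@malg_extendEw d f) ?(@malg_extendEw d g).
- rewrite scaler_sumr -big_split; apply: eq_bigr => k _.
  by rewrite mcoeffD mcoeffZ scalerDl scalerA.
- exact: fsubsetUr.
- exact: fsubsetUl.
- apply: fsubset_trans (msuppD_le _ _) _.
  by rewrite fsetSU // msuppZ_le.
Qed.

HB.instance Definition _ := GRing.isLinear.Build C {malg C[K]} X _ malg_extend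
  malg_extend_is_linear.

Lemma malg_extendU c k : malg_extend << c *g k >> = c *: h k.
Proof. by rewrite (malg_extendEw msuppU_le) big_seq_fset1 mcoeffUU. Qed.

End MalgExtension.

Section StarMorphisms.
Variable C : numClosedFieldType.
Implicit Types A B D : starAlgType C.

Lemma star0 A : star (0 : A) = 0.
Proof. by apply: (addrI (star 0)); rewrite -starD !addr0. Qed.

Lemma starN A (x : A) : star (- x) = - star x.
Proof. by apply: (addrI (star x)); rewrite -starD !subrr star0. Qed.

Lemma starB A (x y : A) : star (x - y) = star x - star y.
Proof. by rewrite starD starN. Qed.

Lemma star1 A : star (1 : A) = 1.
Proof. by have := starM (star (1 : A)) 1; rewrite mulr1 starK mulr1 => <-. Qed.

Lemma star_sum A (I : Type) (r : seq I) (F : I -> A) :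
  star (\sum_(i <- r) F i) = \sum_(i <- r) star (F i).
Proof. exact: (big_morph _ (@starD C A) (star0 A)). Qed.

Section Morphism.
Variables (A B : starAlgType C) (f : A -> B).
Hypothesis fM : star_morphism f.

Lemma star_morphD : {morph f : x y / x + y}.
Proof. by case: fM => fL _ _ x y; rewrite -[x]scale1r fL !scale1r. Qed.

Lemma star_morph0 : f 0 = 0.
Proof. by apply: (addrI (f 0)); rewrite -star_morphD !addr0. Qed.

Lemma star_morphZ c : {morph f : x / c *: x}.
Proof. by case: fM => fL _ _ x; rewrite -[c *: x]addr0 fL star_morph0 addr0. Qed.

Lemma star_morphB : {morph f : x y / x - y}.
Proof. by move=> x y; rewrite star_morphD -scaleN1r star_morphZ scaleN1r. Qed.

Lemma star_morphM : {morph f : x y / x * y}.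
Proof. by case: fM => _ []. Qed.

Lemma star_morph1 : f 1 = 1.
Proof. by case: fM => _ []. Qed.

Lemma star_morph_star x : f (star x) = star (f x).
Proof. by case: fM. Qed.

Lemma star_morph_sum (I : Type) (r : seq I) (F : I -> A) :
  f (\sum_(i <- r) F i) = \sum_(i <- r) f (F i).
Proof. exact: (big_morph _ star_morphD star_morph0). Qed.

Lemma star_image_subalgebra : star_subalgebra (range f).
Proof.
split=> [|c _ _ [x _ <-] [y _ <-]|_ _ [x _ <-] [y _ <-]|_ [x _ <-]].
- by exists 1 => //; apply: star_morph1.
- by exists (c *: x + y) => //; rewrite star_morphD star_morphZ.
- by exists (x * y) => //; apply: star_morphM.
- by exists (star x) => //; apply: star_morph_star.
Qed.

End Morphism.

Section Subalgebra.
Variables (A : starAlgType C) (P : set A).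
Hypothesis PS : star_subalgebra P.

Lemma star_subalgebraD x y : P x -> P y -> P (x + y).
Proof. by case: PS => _ PL _ _ Px Py; rewrite -[x]scale1r; apply: PL. Qed.

Lemma star_subalgebra0 : P 0.
Proof.
case: PS => P1 PL _ _; rewrite -(subrr 1) addrC -[- _]scaleN1r.
exact: PL.
Qed.

Lemma star_subalgebraZ c x : P x -> P (c *: x).
Proof.
case: PS => _ PL _ _ Px; rewrite -[_ *: _]addr0.
exact: PL Px star_subalgebra0.
Qed.

Lemma star_subalgebra_sum (I : Type) (r : seq I) (F : I -> A) :
  (forall i, P (F i)) -> P (\sum_(i <- r) F i).
Proof.
move=> PF; apply: big_ind => //; first exact: star_subalgebra0.
exact: star_subalgebraD.
Qed.

End Subalgebra.

Lemma star_generated_sub A (S T : set A) :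
  star_generated S -> (forall P, star_subalgebra P -> T `<=` P -> S `<=` P) ->
  star_generated T.
Proof. by move=> genS TS P PA TP; apply: genS (TS P PA TP). Qed.

(** The preimage of a star subalgebra under a star morphism is a star subalgebra. *)
Lemma star_generated_image A B (f : A -> B) (S : set A) :
  star_morphism f -> (forall y, exists x, f x = y) ->
  star_generated S -> star_generated (f @` S).
Proof.
move=> fM fS genS P PA SP y; have [x <-] := fS y.
apply: (genS (f @^-1` P)) => [|s Ss]; last by apply: SP; exists s.
case: (PA) => P1 PL PM Pst; split=> [|c u v Pu Pv|u v Pu Pv|u Pu] /=.
- by rewrite /preimage /= (star_morph1 fM).
- rewrite /preimage /= (star_morphD fM) (star_morphZ fM); exact: PL.
- rewrite /preimage /= (star_morphM fM); exact: PM.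
- by rewrite /preimage /= (star_morph_star fM); apply: Pst.
Qed.

End StarMorphisms.

Section FreeUniversal.
Variables (C : numClosedFieldType) (J : choiceType) (A : starAlgType C).
Variable x : J -> A.
Hypothesis x_herm : forall j, star (x j) = x j.

Definition word_eval (w : {fmonom J}) : A := \prod_(j <- w) x j.

Definition free_eval : free_herm C J -> A := malg_extend word_eval.

Let word_evalM v w : word_eval (mmul v w) = word_eval v * word_eval w.
Proof. by rewrite /word_eval fmM big_cat. Qed.

Let word_eval_star w : star (word_eval w) = word_eval (rev_word w).
Proof.
rewrite /word_eval /=; elim: (fmonom_val w) => [|j s IH].
  by rewrite !big_nil star1.
by rewrite big_cons starM IH rev_cons -cats1 big_cat big_seq1 x_herm.
Qed.

Lemma free_eval_gen j : free_eval (herm_gen C j) = x j.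
Proof.
by rewrite /free_eval malg_extendU scale1r /word_eval fmU big_seq1.
Qed.

(** The involution of the free algebra reverses words and fixes letters, so it matches [star] on
    values because every [x j] is hermitian. *)
Lemma free_eval_morphism : star_morphism free_eval.
Proof.
split; first exact: malg_extend_is_linear.
- split=> [|f g].
    apply: etrans (malg_extendU word_eval 1 mone) _.
    by rewrite scale1r /word_eval fm1 big_nil.
  rewrite [f * g]malgME /free_eval linear_sum [in RHS]/malg_extend mulr_suml.
  apply: eq_bigr => v _; rewrite linear_sum mulr_sumr; apply: eq_bigr => w _.
  apply: etrans (malg_extendU word_eval _ _) _.
  by rewrite word_evalM -star_scalerAl -star_scalerAr scalerA.
- move=> f; rewrite -[star f]/(free_star f) /free_star /free_eval linear_sum.
  rewrite [in RHS]/malg_extend star_sum; apply: eq_bigr => w _.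
  apply: etrans (malg_extendU word_eval _ _) _.
  by rewrite starZ word_eval_star.
Qed.

End FreeUniversal.

Lemma free_herm_generated (C : numClosedFieldType) (J : choiceType) :
  star_generated (range (@herm_gen C J)).
Proof.
move=> P PA JP f; case: (PA) => P1 _ PM _.
have PW (s : seq J) : P << FMonom s >>.
  elim: s => [|j s IH]; first by rewrite -fmE.
  suff -> : << FMonom (j :: s) >> = herm_gen C j * << FMonom s >> :> free_herm C J.
    by apply: PM IH; apply: JP; exists j.
  rewrite malgM_def fgmulUU mulr1; congr << _ *g _ >>.
  by apply: val_inj; rewrite /= fmM fmU.
rewrite [f]monalgE; apply: (star_subalgebra_sum PA) => -[s].
suff -> : << f@_(FMonom s) *g FMonom s >> = f@_(FMonom s) *: << FMonom s >> :> free_herm C J.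
  exact: (star_subalgebraZ PA _ (PW s)).
by apply/malgP => v; rewrite mcoeffZ !mcoeffU mulr_natr.
Qed.

Section QuotientUniversal.
Variables (C : numClosedFieldType) (A B : starAlgType C) (S : set A).
Variable g : A -> B.
Hypotheses (gM : star_morphism g) (gS : forall s, S s -> g s = 0).

(** [ideal_gens] also involves elements whose adjoint lies in [S]; [g] kills them too because it
    commutes with [star]. The lift evaluates [g] on a chosen preimage, and the choice is immaterial
    once [g] vanishes on the ideal. *)
Lemma star_quot_lift :
  exists2 f : star_quot S -> B, star_morphism f & forall x, f (star_proj S x) = g x.
Proof.
have gI : {in Defs.span (ideal_gens S), forall x, g x = 0}.
  apply: span_ind => [|x y gx gy|c _ [a [s [b [Ss ->]]]]].
  - exact: star_morph0 gM.
  - by rewrite (star_morphD gM) gx gy addr0.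
  - rewrite (star_morphZ gM) !(star_morphM gM).
    have -> : g s = 0.
      case: Ss => [/gS //|/gS]; rewrite (star_morph_star gM) => gs0.
      by rewrite -[g s]starK gs0 star0.
    by rewrite mulr0 mul0r scaler0.
pose f (q : star_quot S) := g (projT1 (cid (star_proj_surj q))).
have fE x : f (star_proj S x) = g x.
  rewrite /f; case: cid => y /= /star_proj_eq/gI.
  by rewrite (star_morphB gM) => /eqP; rewrite subr_eq0 => /eqP.
have [pL [p1 pM] pst] := star_proj_morphism S.
exists f => //; split=> [c q r||q].
- have [x <-] := star_proj_surj q; have [y <-] := star_proj_surj r.
  by rewrite -pL !fE (star_morphD gM) (star_morphZ gM).
- split=> [|q r]; first by rewrite -p1 fE (star_morph1 gM).
  have [x <-] := star_proj_surj q; have [y <-] := star_proj_surj r.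
  by rewrite -pM !fE (star_morphM gM).
- have [x <-] := star_proj_surj q.
  by rewrite -pst !fE (star_morph_star gM).
Qed.

End QuotientUniversal.

(** * Linear functionals and tensor products *)

Section SeparatingFunctional.
Variables (C : fieldType) (V : lmodType C).

Definition subspace (M : set V) := M 0 /\ forall c x y, M x -> M y -> M (c *: x + y).

Lemma subspaceZ M c x : subspace M -> M x -> M (c *: x).
Proof. by case=> M0 ML Mx; rewrite -[_ *: _]addr0; apply: ML. Qed.

Lemma subspaceB M x y : subspace M -> M x -> M y -> M (x - y).
Proof. by case=> _ ML Mx My; rewrite addrC -scaleN1r; apply: ML. Qed.

(** A subspace maximal among those containing [K] and avoiding [v] has codimension one: adjoining
    any outside [w] must capture [v], and the resulting equation is solved for [w] modulo the
    subspace. *)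
Lemma separating_hyperplane (K : set V) v : subspace K -> ~ K v ->
  exists M : set V, [/\ subspace M, K `<=` M, ~ M v &
    forall w, exists c, M (w - c *: v)].
Proof.
move=> Ksub Kv.
(* Zorn's lemma also asks for an upper bound of the empty chain, hence the
   family is that of the N whose union with K is as wanted. *)
pose P := [set N : set V | subspace (N `|` K) /\ ~ (N `|` K) v].
have [F FP Ftot|N [[Nsub Nv] Nmax]] := @Zorn_bigcup V P.
  split=> [|[[N FN Nv]|//]]; last by case: (FP _ FN) => _; apply; left.
  split=> [|c x y]; first by right; case: Ksub.
  have inF N : F N -> (N `|` K) x -> (N `|` K) y ->
      (\bigcup_(X in F) X `|` K) (c *: x + y).
    move=> FN Nx Ny; case: (FP _ FN) => -[_ NL] _.
    by case: (NL c x y Nx Ny) => h; [left; exists N | right].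
  move=> [[N FN Nx]|Kx] [[N' FN' Ny]|Ky].
  - case: (Ftot _ _ FN FN') => NN'.
      by apply: (inF N') => //; left=> //; apply: NN'.
    by apply: (inF N) => //; left=> //; apply: NN'.
  - by apply: (inF N) => //; [left | right].
  - by apply: (inF N') => //; [right | left].
  - by right; case: Ksub => _; apply.
have Mmax M : subspace M -> N `|` K `<=` M -> ~ M v -> M `<=` N `|` K.
  move=> Msub NKM Mv x Mx; apply: contrapT => Nx.
  have MK : M `|` K = M 
    by apply/seteqP; split=> y; [case=> // Ky; apply: NKM; right | left].
  apply: (Nmax M); last by rewrite /P /mkset MK.
  split=> [y Ny|MN]; first by apply: NKM; left.
  by apply: Nx; left; apply: MN.
exists (N `|` K); split=> // w.
have [Nw|Nw] := pselect ((N `|` K) w); first by exists 0; rewrite scale0r subr0.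
pose M := [set x | exists2 m, (N `|` K) m & exists c, x = m + c *: w].
have NM : N `|` K `<=` M.
  by move=> m Nm; exists m => //; exists 0; rewrite scale0r addr0.
have Mw : M w.
  by exists 0; [case: Nsub | exists 1; rewrite scale1r add0r].
have Msub : subspace M.
  split=> [|c _ _ [m Nm [a ->]] [n Nn [b ->]]]; first by apply: NM; case: Nsub.
  exists (c *: m + n); first by case: Nsub => _; apply.
  by exists (c * a + b); rewrite scalerDr scalerDl scalerA addrACA.
have [[m Nm [c vE]]|Mv] := pselect (M v); last by case: Nw; apply: Mmax Mw.
have c0 : c != 0.
  by apply/eqP => c0; apply: Nv; rewrite vE c0 scale0r addr0.
exists c^-1; rewrite vE scalerDr scalerA mulVf // scale1r opprD addrCA subrr addr0.
by rewrite -scaleN1r; do 2!apply: subspaceZ => //.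
Qed.

(** The functional is the coordinate along [v] modulo the hyperplane; it is well defined because [v]
    lies outside. *)
Lemma separating_functional (K : set V) v : subspace K -> ~ K v ->
  exists2 f : {scalar V}, f v = 1 & forall x, K x -> f x = 0.
Proof.
move=> /separating_hyperplane sepK /sepK[M [Msub KM Mv Mcodim]].
pose f w := projT1 (cid (Mcodim w)).
have fP w : M (w - f w *: v) by rewrite /f; case: cid.
have fE w c : M (w - c *: v) -> f w = c.
  move=> Mc; apply/eqP; rewrite -subr_eq0; apply: contrapT => /negP dc.
  apply: Mv; rewrite -[v]scale1r -(mulVf dc) -scalerA; apply: subspaceZ => //.
  have := subspaceB Msub Mc (fP w); rewrite opprB addrC addrA subrK.
  by rewrite -scalerBl.
have flin : scalar f.
  move=> c x y; apply: fE; rewrite scalerDl opprD addrACA -scalerA -scalerBr.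
  by case: Msub => _; apply.
pose F := GRing.isLinear.Build C V C *%R f flin.
pose g : {scalar V} := HB.pack f F.
exists g => [|x Kx]; apply: fE; first by rewrite scale1r subrr; case: Msub.
by rewrite scale0r subr0; apply: KM.
Qed.

End SeparatingFunctional.

Lemma tensor_lift (C : numClosedFieldType) (V W X : lmodType C)
    (B : V -> W -> X) :
  (forall w, linear (B^~ w)) -> (forall v, linear (B v)) ->
  exists2 F : tensor_product V W -> X, linear F & forall v w, F (tensor v w) = B v w.
Proof.
move=> Bl Br; pose G : {malg C[(V * W)%type]} -> X := malg_extend (fun p => B p.1 p.2).
have GU v w : G << (v, w) >> = B v w by rewrite /G malg_extendU scale1r.
have GL : linear G by exact: malg_extend_is_linear.
have GB x y : G (x - y) = G x - G y by rewrite /G linearB.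
have G0 : {in Defs.span (@bilinear_relations C V W), forall x, G x = 0}.
  apply: span_ind => [|x y Gx Gy|c x Sx].
  - by rewrite /G linear0.
  - by rewrite -[x]scale1r GL Gx Gy scaler0 addr0.
  - rewrite -[c *: _]addr0 GL [G 0]linear0 addr0.
    case: Sx => [[a [v [v' [w ->]]]]|[a [v [w [w' ->]]]]].
      by rewrite GB GL !GU Bl subrr scaler0.
    by rewrite GB GL !GU Br subrr scaler0.
pose F q := G (projT1 (cid (@lproj_surj C _ (@bilinear_relations C V W) q))).
have FE x : F (lproj _ x) = G x.
  rewrite /F; case: cid => y /= /lproj_eq/G0.
  by rewrite GB => /eqP; rewrite subr_eq0 => /eqP.
exists F => [c q r|v w]; last by rewrite /tensor FE GU.
have [x <-] := lproj_surj q; have [y <-] := lproj_surj r.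
by rewrite -lprojZ -lprojD !FE GL.
Qed.

(** * Real orthogonal diagonalization *)

Section RealOrthogonal.
Variable C : numClosedFieldType.

(** The spectral theorem gives a complex eigenvector [v] with real eigenvalue. As [B] is real, the
    conjugate [w] of [v] is an eigenvector too, so the real vector [v + w] works unless it vanishes,
    in which case ['i *: v] is real. *)
Lemma real_symmetric_eigenvector n (B : 'M[C]_n.+1) :
  B \is a realmx -> B^T = B ->
  exists (o : 'rV[C]_n.+1) (l : C),
    [/\ o \is a realmx, o != 0, l \is Num.real & o *m B = l *: o].
Proof.
move=> Breal Bsym.
have Bherm : B \is hermsymmx.
  apply: realsym_hermsym => //; apply/is_hermitianmxP.
  by rewrite expr0 scale1r map_mx_id.
have lreal := hermitian_spectral_diag_real Bherm.
have /orthomx_spectralP BE := hermitian_normalmx Bherm.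
have Punit := spectral_unit B.
set P := spectralmx B in BE Punit; set d := spectral_diag B in BE lreal.
pose v := row 0 P; pose l := d 0 0.
have l_real : l \is Num.real by apply: (mxOverP lreal).
have vB : v *m B = l *: v.
  rewrite /v -row_mul [in LHS]BE !mulmxA mulmxV // mul1mx mul_diag_mx.
  by apply/rowP => j; rewrite !mxE.
have v0 : v != 0.
  apply/eqP => v0; have := mulmxV Punit.
  move/(congr1 (fun M => row 0 M)); rewrite row_mul -/v v0 mul0mx.
  by move/rowP/(_ 0)/eqP; rewrite !mxE eqxx eq_sym oner_eq0.
pose w := map_mx Num.conj v.
have wB : w *m B = l *: w.
  rewrite /w -[B in LHS](realmxC Breal) -map_mxM vB map_mxZ.
  by congr (_ *: _); apply/CrealP.
have [vw|vw] := eqVneq (v + w) 0.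
  exists ('i *: v), l; split=> //; last by rewrite -scalemxAl vB !scalerA mulrC.
    have wE : w = - v by apply/eqP; rewrite -addr_eq0 addrC vw.
    apply/mxOverP => i j; apply/CrealP; rewrite mxE rmorphM /= conjCi.
    have /matrixP/(_ i j) := wE; rewrite !mxE => ->.
    by rewrite mulrNN.
  by rewrite scaler_eq0 negb_or neq0Ci.
exists (v + w), l; split=> //; last by rewrite mulmxDl vB wB scalerDr.
apply/mxOverP => i j; apply/CrealP.
by rewrite !mxE rmorphD /= conjCK addrC.
Qed.

Lemma realmxM m n p (P : 'M[C]_(m, n)) (Q : 'M_(n, p)) :
  P \is a realmx -> Q \is a realmx -> P *m Q \is a realmx.
Proof.
move=> /mxOverP PR /mxOverP QR; apply/mxOverP => i j; rewrite mxE.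
by apply: rpred_sum => k _; apply: rpredM.
Qed.

Lemma realmxT m n (P : 'M[C]_(m, n)) : P \is a realmx -> P^T \is a realmx.
Proof. by move=> /mxOverP PR; apply/mxOverP => i j; rewrite mxE. Qed.

Lemma realmxZ m n (c : C) (P : 'M[C]_(m, n)) :
  c \is Num.real -> P \is a realmx -> c *: P \is a realmx.
Proof. by move=> cR /mxOverP PR; apply/mxOverP => i j; rewrite mxE rpredM. Qed.

Lemma real_sqr_gt0 n (o : 'rV[C]_n) : o \is a realmx -> o != 0 ->
  0 < (o *m o^T) 0 0.
Proof.
move=> /mxOverP oR /rV0Pn[j oj]; rewrite mxE (bigD1 j) //= mxE.
have sq k : 0 <= o 0 k * o 0 k by rewrite -expr2 real_exprn_even_ge0.
rewrite ltr_wpDr //; first by apply: sumr_ge0 => k _; rewrite mxE.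
by rewrite lt_def sq mulf_neq0.
Qed.

(* The reflection exchanging o and the first basis vector e. *)
Lemma householder n (o : 'rV[C]_n.+1) : o \is a realmx -> o *m o^T = 1%:M ->
  exists H : 'M[C]_n.+1, [/\ H \is a realmx, H *m H^T = 1%:M & row 0 H = o].
Proof.
move=> oR o1; pose e : 'rV[C]_n.+1 := row 0 1%:M; pose r := o - e.
have eR : e \is a realmx by apply/mxOverP => i j; rewrite !mxE; case: eqP.
have rR : r \is a realmx.
  by rewrite /r -scaleN1r realmxD // realmxZ // rpredN1.
have [r0|r0] := eqVneq r 0.
  exists 1%:M; split; first by apply/mxOverP => i j; rewrite !mxE; case: eqP.
    by rewrite trmx1 mulmx1.
  by apply/eqP; rewrite eq_sym -subr_eq0 -/e -/r r0.
pose q := (r *m r^T) 0 0; have q_gt0 : 0 < q by apply: real_sqr_gt0.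
have rr : r *m r^T = q%:M by apply: mx11_scalar.
pose M := r^T *m r; pose c := 2 / q; pose H := 1%:M - c *: M.
have MM : M *m M = q *: M.
  by rewrite /M -mulmxA (mulmxA r) rr mul_scalar_mx -scalemxAr.
have HT : H^T = H by rewrite /H linearB linearZ /= trmx1 trmx_mul trmxK.
exists H; split.
- rewrite /H -scaleN1r realmxD // ?realmxZ ?rpredN1 ?realmxM ?realmxT //.
    by apply/mxOverP => i j; rewrite !mxE; case: eqP.
  by rewrite rpred_div ?realn ?gtr0_real.
- rewrite HT {2}/H mulmxBr mulmx1 -scalemxAr /H mulmxBl mul1mx -scalemxAl MM.
  rewrite scalerBr !scalerA opprB.
  have -> : c * c * q = c + c.
    by rewrite -mulrA {2}/c divfK ?gt_eqF // mulr_natr mulr2n.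
  by rewrite scalerDl addrK subrK.
(* Both [o] and [e] are unit vectors, which fixes the square norm of their difference [r];
   consequently [e *m H] is [e + r], that is [o]. *)
- have qE : q = 2 * (1 - o 0 0).
    rewrite /q /r linearB /= mulmxBl !mulmxBr o1.
    have eoT : e *m o^T = (o 0 0)%:M.
      by rewrite /e -row_mul mul1mx [LHS]mx11_scalar !mxE.
    have -> : o *m e^T = (o 0 0)%:M.
      by rewrite -[LHS]trmxK trmx_mul trmxK eoT tr_scalar_mx.
    have -> : e *m e^T = 1%:M.
      by rewrite {1}/e -row_mul mul1mx [LHS]mx11_scalar !mxE.
    rewrite eoT.
    by rewrite !mxE eqxx mulr1n opprB mulr_natl mulr2n.
  have eM : e *m M = (o 0 0 - 1) *: r.
    rewrite /M mulmxA; have -> : e *m r^T = (o 0 0 - 1)%:M.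
      by rewrite /e -row_mul mul1mx [LHS]mx11_scalar !mxE.
    by rewrite mul_scalar_mx.
  have <- : e *m H = row 0 H by rewrite /e -row_mul mul1mx.
  rewrite /H mulmxBr mulmx1 -scalemxAr eM scalerA.
  have -> : c * (o 0 0 - 1) = -1.
    rewrite /c -opprB mulrN mulrAC -qE mulfV // gt_eqF //.
  by rewrite scaleN1r opprK /r addrC subrK.
Qed.

End RealOrthogonal.

(** * Symmetric tensors and hermitian phases *)

Lemma antisymmetrized (C : comNzRingType) (V : lmodType C) (w p q : C) (x y : V) :
  (w * (p - q)) *: (x + y) - (p + q) *: (w *: (x - y))
    = w *: (2 *: (p *: y - q *: x)).
Proof.
rewrite scalerBr !scalerDr !scalerN !scalerA opprD opprK addrACA addrC.
rewrite -scalerDl -scalerBl -[- (_ *: x)]scaleNr.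
by congr (_ *: _ + _ *: _); ring.
Qed.

Section Phases.
Variables (C : numClosedFieldType) (A : starAlgType C).

Definition mxact m n (P : 'M[C]_(m, n)) (z : 'I_n -> A) (i : 'I_m) : A :=
  \sum_j P i j *: z j.

Lemma mxactM m n p (P : 'M_(m, n)) (Q : 'M_(n, p)) (z : 'I_p -> A) i :
  mxact (P *m Q) z i = mxact P (mxact Q z) i.
Proof.
rewrite /mxact.
under [RHS]eq_bigr do rewrite scaler_sumr; rewrite exchange_big /=.
apply: eq_bigr => k _; rewrite mxE scaler_suml.
by apply: eq_bigr => j _; rewrite scalerA.
Qed.

Lemma eq_mxact m n (P : 'M_(m, n)) (z z' : 'I_n -> A) i :
  z =1 z' -> mxact P z i = mxact P z' i.
Proof. by move=> zz'; apply: eq_bigr => j _; rewrite zz'. Qed.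

Lemma mxact1 n (z : 'I_n -> A) i : mxact 1%:M z i = z i.
Proof.
rewrite /mxact (bigD1 i) //= mxE eqxx scale1r big1 ?addr0 // => j ji.
by rewrite mxE eq_sym (negPf ji) scale0r.
Qed.

(* [\sum_i z i (x) star (z i)] is a symmetric tensor, tested on functionals of
   the first factor. *)
Definition tensor_symmetric n (z : 'I_n -> A) :=
  forall f : {scalar A}, \sum_i f (z i) *: star (z i) = \sum_i f (star (z i)) *: z i.

Lemma star_real_act m n (P : 'M[C]_(m, n)) (z : 'I_n -> A) i :
  P \is a realmx -> star (mxact P z i) = mxact P (star \o z) i.
Proof.
move=> /mxOverP PR; rewrite star_sum; apply: eq_bigr => j _.
by rewrite starZ (CrealP (PR i j)).
Qed.

Lemma scalar_act (f : {scalar A}) m n (P : 'M[C]_(m, n)) (z : 'I_n -> A) i :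
  f (mxact P z i) = \sum_j P i j * f (z j).
Proof. by rewrite linear_sum; apply: eq_bigr => j _; rewrite linearZ. Qed.

(** Both sides contract the tensor sum of the z_i ⊗ w_i with [f] on the first factor, and this
    tensor is unchanged when an orthogonal matrix acts on both families. *)
Lemma orthogonal_bilinear (f : {scalar A}) n (H : 'M[C]_n) (z w : 'I_n -> A) :
  H^T *m H = 1%:M ->
  \sum_i f (mxact H z i) *: mxact H w i = \sum_i f (z i) *: w i.
Proof.
move=> H1; transitivity (\sum_j f (z j) *: mxact (H^T *m H) w j); last first.
  by apply: eq_bigr => j _; rewrite H1 mxact1.
under eq_bigr do rewrite scalar_act scaler_suml.
rewrite exchange_big /=; apply: eq_bigr => j _.
rewrite mxactM [in RHS]/mxact scaler_sumr; apply: eq_bigr => i _.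
by rewrite mxE scalerA mulrC.
Qed.

Lemma tensor_symmetric_orthogonal n (H : 'M[C]_n) (z : 'I_n -> A) :
  H \is a realmx -> H^T *m H = 1%:M -> tensor_symmetric z ->
  tensor_symmetric (mxact H z).
Proof.
move=> HR H1 zS f; have := zS f.
rewrite -(orthogonal_bilinear f z (star \o z) H1).
rewrite -(orthogonal_bilinear f (star \o z) z H1) => E.
under eq_bigr do rewrite star_real_act //.
by under [RHS]eq_bigr do rewrite star_real_act //.
Qed.

Lemma polar (c : C) : exists e r : C, [/\ `|e| = 1, r \is Num.real & c = e * r].
Proof.
have [->|c0] := eqVneq c 0; first by exists 1, 0; rewrite normr1 mulr0.
exists (c / `|c|), `|c|; rewrite normr_real divfK ?normr_eq0 //; split=> //.
by rewrite normrM normfV normr_id divff ?normr_eq0.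
Qed.

(** This is the induction step of [hermitian_phases]. Writing z = (a + i b)/2 with a and b
    hermitian, it suffices to find a real direction in which a and b are real multiples of one
    hermitian element. *)
Lemma real_phase_vector n (z : 'I_n.+1 -> A) : tensor_symmetric z ->
  exists (o : 'rV[C]_n.+1) (e : C) (x : A),
  [/\ o \is a realmx, o != 0, `|e| = 1, star x = x & mxact o z 0 = e *: x].
Proof.
move=> zS; pose a i := z i + star (z i); pose b i := - 'i *: (z i - star (z i)).
have a_herm i : star (a i) = a i by rewrite /a starD starK addrC.
have b_herm i : star (b i) = b i.
  by rewrite /b starZ starB starK rmorphN /= conjCi opprK -[_ - z i]opprB scalerN scaleNr.
have zE i : z i = 2^-1 *: (a i + 'i *: b i).
  rewrite /a /b scalerA mulrN -expr2 sqrCi opprK scale1r addrACA subrr addr0.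
  by rewrite -mulr2n -scaler_nat scalerA mulVf ?scale1r ?pnatr_eq0.
(* The tensor sum of the b_i ⊗ a_i is symmetric: expanding a and b, its defect of symmetry is -2i
   times that of z. *)
have abS (f : {scalar A}) : \sum_i f (b i) *: a i = \sum_i f (a i) *: b i.
  apply/eqP; rewrite -subr_eq0 -sumrB; apply/eqP.
  transitivity (- 'i *: (2 *: \sum_i (f (z i) *: star (z i) - f (star (z i)) *: z i))).
    rewrite !scaler_sumr; apply: eq_bigr => i _.
    have -> : f (b i) = - 'i * (f (z i) - f (star (z i))) by rewrite linearZ linearB.
    have -> : f (a i) = f (z i) + f (star (z i)) by rewrite linearD.
    exact: antisymmetrized.
  by rewrite sumrB zS subrr !scaler0.
have zE' o : mxact o z 0 = 2^-1 *: (mxact o a 0 + 'i *: mxact o b 0).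
  rewrite scaler_sumr -big_split scaler_sumr; apply: eq_bigr => i _.
  transitivity (2^-1 *: (o 0 i *: (a i + 'i *: b i))).
    by rewrite zE [LHS]scalerA [RHS]scalerA mulrC.
  by rewrite /= [o 0 i *: _]scalerDr !scalerA ['i * _]mulrC.
have act_herm o (x : 'I_n.+1 -> A) : o \is a realmx -> (forall i, star (x i) = x i) ->
    star (mxact o x 0) = mxact o x 0.
  by move=> oR xh; rewrite star_real_act //; apply: eq_mxact.
pose K i : set A := [set x | exists2 c : 'rV[C]_n.+1, c 0 i = 0 & x = mxact c a 0].
(* If the a_i are dependent, a real relation between them leaves i/2 times a
   hermitian element; otherwise functionals dual to a give b = B a with B real
   symmetric, and an eigenvector of B does. *)
have [[i [c ci ai]]|aK] := pselect (exists i, K i (a i)).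
  pose d := c - row i 1%:M.
  have da : mxact d a 0 = 0.
    transitivity (mxact c a 0 - mxact 1%:M a i); last by rewrite mxact1 -ai subrr.
    by rewrite /mxact -sumrB; apply: eq_bigr => j _; rewrite !mxE scalerBl.
  (* Adding its adjoint to the relation makes the coefficients real, as the [a j] are hermitian. The
     coefficient at [i] becomes -2, so [o] is nonzero. *)
  pose o := map_mx (fun c => c + c^*) d.
  have oR : o \is a realmx.
    by apply/mxOverP => k j; apply/CrealP; rewrite mxE rmorphD /= conjCK addrC.
  exists o, 'i, (2^-1 *: mxact o b 0); split=> //.
  - apply/rV0Pn; exists i; rewrite !mxE ci eqxx sub0r rmorphN rmorph_nat.
    by rewrite -opprD oppr_eq0 -natrD pnatr_eq0.
  - by rewrite normCi.
  - by rewrite starZ act_herm // conj_Creal // rpredV realn.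
  - rewrite zE' !scalerA mulrC.
    suff -> : mxact o a 0 = 0 by rewrite add0r scalerA.
    transitivity (mxact d a 0 + star (mxact d a 0)); last by rewrite da star0 addr0.
    rewrite star_sum -big_split; apply: eq_bigr => j _.
    by rewrite mxE starZ a_herm scalerDl.
have dual i : exists2 f : {scalar A}, f (a i) = 1 & forall j, j != i -> f (a j) = 0.
  have [||f fi fK] := @separating_functional C A (K i) (a i).
  - split=> [|c _ _ [u ui ->] [v vi ->]].
      by exists 0; rewrite ?mxE // /mxact big1 // => j _; rewrite mxE scale0r.
    exists (c *: u + v); first by rewrite !mxE ui vi mulr0 addr0.
    rewrite scaler_sumr -big_split; apply: eq_bigr => j _.
    by rewrite !mxE scalerDl scalerA.
  - by move=> Ki; apply: aK; exists i.
  exists f => // j ji; apply: fK; exists (row j 1%:M).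
    by rewrite !mxE (negPf ji).
  transitivity (mxact 1%:M a j); first by rewrite mxact1.
  by apply: eq_bigr => k _; rewrite !mxE.
pose f i := projT1 (cid2 (dual i)).
have fE i j : f i (a j) = (i == j)%:R.
  rewrite /f; case: cid2 => g /= gi gj; case: eqVneq => [<- //|ij].
  by rewrite gj // eq_sym.
pose B : 'M[C]_n.+1 := \matrix_(i, j) f i (b j).
(* By [abS] for the dual functional [f i], the right side is the sum over j of f_i(a_j) b_j, which
   reduces to [b i]. *)
have bE i : b i = mxact B a i.
  rewrite -[LHS](mxact1 b i) [RHS](eq_bigr (fun j => f i (b j) *: a j)); last first.
    by move=> j _; rewrite mxE.
  by rewrite abS; apply: eq_bigr => j _; rewrite fE mxE.
have fact (P : 'M[C]_n.+1) k i : f k (mxact P a i) = P i k.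
  rewrite scalar_act (bigD1 k) //= fE eqxx mulr1 big1 ?addr0 // => j jk.
  by rewrite fE eq_sym (negPf jk) mulr0.
have Bsym : B^T = B by apply/matrixP => i j; rewrite mxE [LHS]mxE bE fact.
(* All [a j] and [b i] are hermitian, so applying [star] to [bE] conjugates the coefficients, and
   the dual functionals read them off. *)
have Breal : B \is a realmx.
  apply/mxOverP => i k; apply/CrealP.
  have := b_herm i; rewrite {1}bE star_sum => /(congr1 (f k)).
  rewrite bE fact => BikE; rewrite -[RHS]BikE.
  transitivity (f k (mxact (map_mx Num.conj B) a i)); first by rewrite fact [RHS]mxE.
  congr (f k _); apply: eq_bigr => j _.
  by rewrite [X in X *: _]mxE starZ a_herm.
have [o [l [oR o0 lR oB]]] := real_symmetric_eigenvector Breal Bsym.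
have ob : mxact o b 0 = l *: mxact o a 0.
  rewrite (eq_mxact _ _ bE) -mxactM oB /mxact scaler_sumr.
  by apply: eq_bigr => j _; rewrite mxE scalerA.
(* Along [o], z is (1 + i l)/2 times a hermitian element. The real factor of this scalar is absorbed
   into that element and only the phase remains. *)
have [e [r [e1 rR lE]]] := polar (2^-1 * (1 + 'i * l)).
exists o, e, (r *: mxact o a 0); split=> //.
  by rewrite starZ act_herm // (CrealP rR).
by rewrite zE' ob !scalerA -[X in X + _]scale1r -scalerDl scalerA lE.
Qed.

End Phases.

(** By induction on [n]: normalize the direction given by [real_phase_vector], complete it to an
    orthogonal matrix by a reflection, then treat the other components with a block matrix. *)
Lemma hermitian_phases (C : numClosedFieldType) (A : starAlgType C) n
    (z : 'I_n -> A) : tensor_symmetric z ->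
  exists (O : 'M[C]_n) (e : 'I_n -> C) (x : 'I_n -> A),
  [/\ O \is a realmx, O *m O^T = 1%:M, forall i, `|e i| = 1,
      forall i, star (x i) = x i & forall i, mxact O z i = e i *: x i].
Proof.
elim: n z => [|n IH] z zS.
  exists 1%:M, (fun=> 1), z; split; try by case.
    by apply/mxOverP => -[].
  by rewrite trmx1 mulmx1.
have [o [e0 [x0 [oR o0 e01 x0h oz]]]] := real_phase_vector zS.
have q_gt0 := real_sqr_gt0 oR o0; set q := (o *m o^T) 0 0 in q_gt0.
pose s := (sqrtC q)^-1.
have sR : s \is Num.real by rewrite ger0_real // invr_ge0 sqrtC_ge0 ltW.
have sq : s * (s * q) = 1.
  by rewrite mulrA -expr2 exprVn sqrtCK mulVf // gt_eqF.
have [H [HR H1 Ho]] : exists H : 'M[C]_n.+1,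
    [/\ H \is a realmx, H *m H^T = 1%:M & row 0 H = s *: o].
  apply: householder; first exact: realmxZ.
  rewrite linearZ /= -scalemxAl -scalemxAr [o *m _]mx11_scalar -/q.
  by rewrite !scale_scalar_mx sq.
pose z' := mxact H z.
have z'0 : z' 0 = e0 *: (s *: x0).
  rewrite /z' scalerA mulrC -scalerA -oz scaler_sumr; apply: eq_bigr => j _.
  by have /rowP/(_ j) := Ho; rewrite !mxE scalerA => ->.
have z'S : tensor_symmetric z'.
  by apply: tensor_symmetric_orthogonal => //; apply: mulmx1C.
have [f|O [e [x [OR O1 e1 xh Oz]]]] := IH (fun k => z' (rshift 1 k)).
  have := z'S f; rewrite !(@big_split_ord _ _ _ 1 n) /= !big_ord1.
  have -> : lshift n (0 : 'I_1) = 0 by apply: val_inj.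
  (* The first component is a phase times a hermitian element, so it contributes equally to both
     sides; cancelling it leaves the symmetry of the remaining components. *)
  have -> : f (z' 0) *: star (z' 0) = f (star (z' 0)) *: z' 0.
    have fx c d : f (c *: (d *: x0)) = c * (d * f x0) by rewrite !linearZ.
    rewrite z'0 !starZ x0h (CrealP sR) !fx !scalerA.
    by congr (_ *: _); ring.
  by move/addrI.
pose OO : 'M[C]_(1 + n) := block_mx 1%:M 0 0 O.
have OO1 : OO *m OO^T = 1%:M.
  rewrite /OO tr_block_mx mulmx_block.
  by rewrite !trmx0 !mul0mx !mulmx0 !addr0 add0r trmx1 mulmx1 O1 -scalar_mx_block.
have OOul i j : OO (lshift n i) (lshift n j) = (1%:M : 'M_1) i j.
  exact: block_mxEul.
have OOur i j : OO (lshift n i) (rshift 1 j) = 0.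
  by rewrite [LHS]block_mxEur mxE.
have OOdl i j : OO (rshift 1 i) (lshift n j) = 0.
  by rewrite [LHS]block_mxEdl mxE.
have OOdr i j : OO (rshift 1 i) (rshift 1 j) = O i j.
  exact: block_mxEdr.
exists (OO *m H), (fun i => if @fintype.split 1 n i is inr k then e k else e0),
  (fun i => if @fintype.split 1 n i is inr k then x k else s *: x0).
split=> [||i|i|i].
- apply: realmxM => //; apply/mxOverP => i j; rewrite -(@splitK 1 n i) -(@splitK 1 n j).
  case: (@fintype.split 1 n i) => i'; case: (@fintype.split 1 n j) => j' /=.
  + by rewrite OOul mxE; case: eqP.
  + by rewrite OOur.
  + by rewrite OOdl.
  + by rewrite OOdr (mxOverP OR).
- rewrite trmx_mul mulmxA -(mulmxA OO) H1 mulmx1; exact: OO1.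
- by case: fintype.split.
- by case: fintype.split => // _; rewrite starZ x0h (CrealP sR).
- rewrite mxactM -/z' {1}/mxact (@big_split_ord _ _ _ 1 n) /= big_ord1.
  have -> : z' (lshift n (0 : 'I_1)) = z' 0 by congr z'; apply: val_inj.
  rewrite -(@splitK 1 n i) unsplitK; case: (@fintype.split 1 n i) => k /=.
    rewrite OOul ord1 mxE eqxx scale1r z'0 big1 ?addr0 // => j _.
    by rewrite OOur scale0r.
  rewrite OOdl scale0r add0r -Oz.
  by apply: eq_bigr => j _; rewrite OOdr.
Qed.

(** * Quaternionic matrices *)

Lemma sum_ordS (V : nmodType) (k : 'I_3) (F : 'I_3 -> V) :
  \sum_i F i = F k + F (ordS k) + F (ordS (ordS k)).
Proof.
rewrite (bigD1 k) //= (bigD1 (ordS k)) /=; last by case: k => -[|[|[]]].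
rewrite (bigD1 (ordS (ordS k))) /=; last by case: k => -[|[|[]]].
rewrite big1 ?addr0 ?addrA // => i.
by case: k i => -[|[|[|//]]] ? [[|[|[|//]]] ?].
Qed.

Lemma ordS3 (k : 'I_3) : ordS (ordS (ordS k)) = k.
Proof. by apply: val_inj; case: k => -[|[|[]]]. Qed.

Lemma sum_shift (V : nmodType) (F : 'I_3 -> V) : \sum_i F (ordS i) = \sum_i F i.
Proof.
rewrite [RHS](reindex (@ordS 3)) //=.
by exists (@ordS 3 \o @ordS 3) => k _ /=; rewrite ordS3.
Qed.

Section Quaternions.
Variable R : realType.
Local Notation C := R[i].

Definition ctr (M : 'M[C]_2) : 'M[C]_2 := map_mx Num.conj M^T.

Lemma ctrM M N : ctr (M *m N) = ctr N *m ctr M.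
Proof. by rewrite /ctr trmx_mul map_mxM. Qed.

Lemma ctrK : involutive ctr.
Proof. by move=> M; apply/matrixP => i j; rewrite !mxE conjCK. Qed.

Lemma ctrD : {morph ctr : M N / M + N}.
Proof. by move=> M N; rewrite /ctr linearD /= map_mxD. Qed.

Lemma ctr0 : ctr 0 = 0.
Proof. by rewrite /ctr trmx0 map_mx0. Qed.

Lemma ctrZ c M : ctr (c *: M) = c^* *: ctr M.
Proof. by rewrite /ctr linearZ /= map_mxZ. Qed.

Lemma ctr1 : ctr 1%:M = 1%:M.
Proof. by rewrite /ctr trmx1 map_mx1. Qed.

(* The quaternion relations for the matrices i sigma_k, whence the sign in
   S_1 S_2 = - S_3. *)
Definition quaternionic (S : 'I_3 -> 'M[C]_2) := forall k,
  [/\ ctr (S k) = - S k, S k *m S k = - 1%:M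
    & S k *m S (ordS k) = - S (ordS (ordS k))].

Section Triple.
Variable S : 'I_3 -> 'M[C]_2.
Hypothesis SQ : quaternionic S.

(** This is the adjoint of the product relation at index [ordS (ordS k)]; the signs of the two
    antihermitian factors cancel, and the one on the right disappears. *)
Lemma quaternion_prev k : S k *m S (ordS (ordS k)) = S (ordS k).
Proof.
have [S1 _ _] := SQ k; have [S2 _ _] := SQ (ordS k).
have [S3 _ e] := SQ (ordS (ordS k)); rewrite ordS3 in e.
apply: (can_inj ctrK).
by rewrite ctrM S1 S3 mulmxN mulNmx opprK e S2.
Qed.

(** The products of the other two matrices in the two orders are [S k] and [- S k], and they have
    the same trace. *)
Lemma quaternion_trace k : \tr (S k) = 0.
Proof.
have [_ _ e] := SQ (ordS k); have p := quaternion_prev (ordS (ordS k)).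
rewrite !ordS3 in e p.
have := mxtrace_mulC (S (ordS k)) (S (ordS (ordS k))).
by rewrite e p linearN /= => /eqP; rewrite eq_sym -addr_eq0 -mulr2n mulrn_eq0 => /eqP.
Qed.

Definition quat (mu : 'I_4) : 'M[C]_2 := if unlift ord0 mu is Some k then S k else 1%:M.

Lemma quat_orthogonal mu nu : \tr (ctr (quat mu) *m quat nu) = (mu == nu)%:R *+ 2.
Proof.
rewrite /quat; case: (unliftP ord0 mu) => [k ->|->]; case: (unliftP ord0 nu) => [l ->|->].
- have [-> e1 e2] := SQ k.
  rewrite mulNmx linearN /= (inj_eq lift_inj).
  have [<-|kl] := eqVneq k l; first by rewrite e1 linearN /= opprK mxtrace1.
  have : (l == ordS k) || (l == ordS (ordS k)).
    by case: k l kl {e1 e2} => -[|[|[|//]]] ? [[|[|[|//]]] ?].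
  case/orP => /eqP->; first by rewrite e2 linearN /= quaternion_trace !oppr0 mul0rn.
  by rewrite quaternion_prev quaternion_trace oppr0 mul0rn.
- by have [-> _ _] := SQ k; rewrite mulmx1 linearN /= quaternion_trace oppr0 mul0rn.
- by rewrite ctr1 mul1mx quaternion_trace mul0rn.
- by rewrite ctr1 mul1mx mxtrace1 eqxx.
Qed.

End Triple.

(** These are i sigma_1, i sigma_2, i sigma_3 for the Pauli matrices, indexed from 0. The exponent
    [i] is the row index, while ['i] is the imaginary unit. *)
Definition ipauli (k : 'I_3) : 'M[C]_2 := \matrix_(i, j)
  match val k with
  | 0%N => if i == j then 0 else 'i
  | 1%N => if i == j then 0 else (-1) ^+ i
  | _ => if i == j then (-1) ^+ i * 'i else 0
  end.

Lemma ipauli_quaternionic : quaternionic ipauli.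
Proof.
have iM : 'i * 'i = -1 :> C by rewrite -expr2 sqrCi.
have b00 : bump 0 0 = 1%N by [].
case=> -[|[|[|//]]] h; split; apply/matrixP => -[[|[|//]] ?] [[|[|//]] ?];
 rewrite !(mxE, big_ord_recl, big_ord0) /= ?b00 ?expr0 ?expr1;
 rewrite ?(rmorphM, rmorphN, rmorph0, rmorph1) /= ?(conjCi, rmorphN1, rmorph1);
 by rewrite ?(mul1r, mulr1, mul0r, mulr0, mulN1r, mulrN1, mulrN, mulNr, add0r,
   addr0, oppr0, opprK, iM).
Qed.

(** * Quaternionic matrices with coefficients in a star algebra *)

Variable A : starAlgType C.
Implicit Types (M N : 'M[A]_2) (a b : A).

Definition kron (S : 'M[C]_2) a : 'M[A]_2 := \matrix_(i, j) (S i j *: a).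

Lemma kronM S T a b : kron S a *m kron T b = kron (S *m T) (a * b).
Proof.
apply/matrixP => i j; rewrite !mxE scaler_suml; apply: eq_bigr => k _.
by rewrite !mxE -star_scalerAl -star_scalerAr scalerA.
Qed.

Lemma kronDr S : {morph kron S : a b / a + b}.
Proof. by move=> a b; apply/matrixP => i j; rewrite !mxE scalerDr. Qed.

Lemma kron0 S : kron S 0 = 0.
Proof. by apply/matrixP => i j; rewrite !mxE scaler0. Qed.

Lemma kronNl S a : kron (- S) a = kron S (- a).
Proof. by apply/matrixP => i j; rewrite !mxE scalerN scaleNr. Qed.

Lemma kronZ c S a : kron (c *: S) a = kron S (c *: a).
Proof. by apply/matrixP => i j; rewrite !mxE scalerA mulrC. Qed.

Lemma kron_scalar a : kron 1%:M a = a%:M.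
Proof.
apply/matrixP => i j; rewrite !mxE.
by case: eqP; rewrite ?scale1r ?scale0r.
Qed.

Lemma kron_sumr S (I : Type) (r : seq I) (F : I -> A) :
  kron S (\sum_(i <- r) F i) = \sum_(i <- r) kron S (F i).
Proof. exact: (big_morph _ (kronDr S) (kron0 S)). Qed.

Lemma kron_suml (I : Type) (r : seq I) (F : I -> 'M[C]_2) a :
  kron (\sum_(i <- r) F i) a = \sum_(i <- r) kron (F i) a.
Proof.
apply: (big_morph (kron^~ a)) => [S T|]; apply/matrixP => i j; rewrite !mxE.
  by rewrite scalerDl.
by rewrite scale0r.
Qed.

Lemma adjointD M N : adjoint (M + N) = adjoint M + adjoint N.
Proof. by apply/matrixP => i j; rewrite !mxE starD. Qed.

Lemma adjointM M N : adjoint (M *m N) = adjoint N *m adjoint M.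
Proof.
apply/matrixP => i j; rewrite !mxE star_sum; apply: eq_bigr => k _.
by rewrite !mxE starM.
Qed.

Lemma adjoint_kron S a : adjoint (kron S a) = kron (ctr S) (star a).
Proof. by apply/matrixP => i j; rewrite !mxE starZ. Qed.

Section Qform.
Variable S : 'I_3 -> 'M[C]_2.
Hypothesis SQ : quaternionic S.
Implicit Type y w : 'I_3 -> A.

Definition qform a y : 'M[A]_2 := kron 1%:M a + \sum_k kron (S k) (y k).

Lemma qformE (y : 'I_4 -> A) :
  qform (y ord0) (y \o lift ord0) = \sum_mu kron (quat S mu) (y mu).
Proof.
rewrite big_ord_recl /quat unlift_none; congr (_ + _).
by apply: eq_bigr => k _; rewrite liftK.
Qed.

Lemma adjoint_qform a y : adjoint (qform a y) = qform (star a) (fun k => - star (y k)).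
Proof.
rewrite adjointD adjoint_kron ctr1; congr (_ + _).
rewrite (big_morph _ adjointD (id1 := 0)); last first.
  by apply/matrixP => i j; rewrite !mxE star0.
by apply: eq_bigr => k _; rewrite adjoint_kron; have [-> _ _] := SQ k; rewrite kronNl.
Qed.

(** This is the quaternion product with noncommuting coefficients; the cross product enters with a
    minus sign because S_1 S_2 = - S_3. *)
Lemma qformM a y b w : qform a y *m qform b w =
  qform (a * b - \sum_k y k * w k) (fun k => a * w k + y k * b
    - (y (ordS k) * w (ordS (ordS k)) - y (ordS (ordS k)) * w (ordS k))).
Proof.
have double_sum : (\sum_k kron (S k) (y k)) *m (\sum_k kron (S k) (w k)) =
    kron 1%:M (- \sum_k y k * w k) + \sum_k kron (S k)
      (- (y (ordS k) * w (ordS (ordS k)) - y (ordS (ordS k)) * w (ordS k))).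
  rewrite mulmx_suml -sumrN kron_sumr.
  (* The second index is listed cyclically from [k]: the first block consists of the squares, and
     the other two give the cross product after cyclic shifts of the summation index. *)
  under eq_bigr => k do rewrite mulmx_sumr (sum_ordS k) !kronM.
  rewrite !big_split /= -addrA; congr (_ + _).
    by apply: eq_bigr => k _; have [_ -> _] := SQ k; rewrite kronNl.
  under [RHS]eq_bigr do rewrite opprB addrC kronDr.
  rewrite big_split /=; congr (_ + _).
    rewrite -[RHS]sum_shift -[RHS]sum_shift.
    apply: eq_bigr => k _; have [_ _ ->] := SQ k.
    by rewrite !ordS3 kronNl.
  rewrite -[RHS]sum_shift; apply: eq_bigr => k _.
  by rewrite quaternion_prev // !ordS3.
rewrite /qform mulmxDl !mulmxDr double_sum !kronM mulmx1 kronDr.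
rewrite mulmx_sumr mulmx_suml.
under eq_bigr do rewrite kronM mul1mx.
under [X in _ + (X + _)]eq_bigr do rewrite kronM mulmx1.
under [X in _ = _ + X]eq_bigr do rewrite !kronDr.
rewrite !big_split /= -!addrA; congr (_ + _); rewrite [RHS]addrCA; congr (_ + _).
by rewrite [RHS]addrCA.
Qed.

(** The pairing of [M] with [quat S mu] for the trace form; by [slice_quat] it is twice the
    corresponding component. *)
Definition slice (mu : 'I_4) M : A := \sum_i \sum_j (quat S mu i j)^* *: M i j.

Lemma slice_kron mu T a : slice mu (kron T a) = \tr (ctr (quat S mu) *m T) *: a.
Proof.
rewrite /slice exchange_big scaler_suml; apply: eq_bigr => i _.
rewrite mxE scaler_suml; apply: eq_bigr => j _.
by rewrite !mxE scalerA.
Qed.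

Lemma slice_sum mu (I : Type) (r : seq I) (F : I -> 'M[A]_2) :
  slice mu (\sum_(i <- r) F i) = \sum_(i <- r) slice mu (F i).
Proof.
rewrite /slice [RHS]exchange_big; apply: eq_bigr => i _.
rewrite [RHS]exchange_big; apply: eq_bigr => j _.
by rewrite summxE scaler_sumr.
Qed.

Lemma slice_quat mu (y : 'I_4 -> A) :
  slice mu (\sum_nu kron (quat S nu) (y nu)) = 2 *: y mu.
Proof.
rewrite slice_sum (bigD1 mu) //= slice_kron quat_orthogonal // eqxx.
rewrite big1 ?addr0 // => nu numu.
by rewrite slice_kron quat_orthogonal // eq_sym (negPf numu) mul0rn scale0r.
Qed.

Lemma qform_inj a y b w : qform a y = qform b w -> a = b /\ y =1 w.
Proof.
pose v c (z : 'I_3 -> A) mu := if unlift ord0 mu is Some k then z k else c.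
have vE c z : qform c z = \sum_mu kron (quat S mu) (v c z mu).
  rewrite -qformE /v unlift_none; congr (_ + _).
  by apply: eq_bigr => k _ /=; rewrite liftK.
rewrite !vE => E.
have vv mu : v a y mu = v b w mu.
  have := congr1 (slice mu) E; rewrite !slice_quat.
  by apply: scalerI; rewrite pnatr_eq0.
split; first by have := vv ord0; rewrite /v unlift_none.
by move=> k; have := vv (lift ord0 k); rewrite /v liftK.
Qed.

(** As [adjoint M j i] is [star (M i j)], expanding the second argument produces conjugate
    coefficients, which assemble the first arguments into slices of [M]. Each slice contributes the
    factor 2. *)
Lemma frobenius_bilinear (X : lmodType C) (B : A -> A -> X) (y : 'I_4 -> A) M :
  (forall t, linear (B^~ t)) -> (forall v, linear (B v)) ->
  M = \sum_mu kron (quat S mu) (y mu) ->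
  \sum_i \sum_j B (M i j) (adjoint M j i) = 2 *: \sum_mu B (y mu) (star (y mu)).
Proof.
move=> Bl Br ME.
have BlD t : {morph B^~ t : u v / u + v}.
  by move=> u v; rewrite -[u]scale1r Bl !scale1r.
have Bl0 t : B 0 t = 0 by apply: (addrI (B 0 t)); rewrite -BlD !addr0.
have BlZ c u t : B (c *: u) t = c *: B u t by rewrite -[c *: u]addr0 Bl Bl0 addr0.
have BrD v : {morph B v : u t / u + t}.
  by move=> u t; rewrite -[u]scale1r Br !scale1r.
have Br0 v : B v 0 = 0 by apply: (addrI (B v 0)); rewrite -BrD !addr0.
have BrZ c u t : B u (c *: t) = c *: B u t by rewrite -[c *: t]addr0 Br Br0 addr0.
transitivity (\sum_mu B (slice mu M) (star (y mu))); last first.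
  by rewrite scaler_sumr; apply: eq_bigr => mu _; rewrite ME slice_quat BlZ.
rewrite /slice.
under [RHS]eq_bigr => mu _.
  rewrite (big_morph (B^~ _) (BlD _) (Bl0 _)).
  under eq_bigr => i _.
    rewrite (big_morph (B^~ _) (BlD _) (Bl0 _)).
    under eq_bigr do rewrite BlZ.
    over.
  over.
rewrite [RHS]exchange_big; apply: eq_bigr => i _.
rewrite [RHS]exchange_big; apply: eq_bigr => j _.
rewrite [adjoint _ _ _]mxE {2}ME summxE star_sum (big_morph _ (BrD _) (Br0 _)).
by apply: eq_bigr => mu _; rewrite [kron _ _ _ _]mxE starZ BrZ.
Qed.

End Qform.

End Quaternions.

(** * Orthonormal frames of real quaternions *)

Section Frames.
Variable R : realType.
Local Notation C := R[i].
Local Notation tau := (quat (@ipauli R)).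

Lemma quat_clifford (S : 'I_3 -> 'M[C]_2) mu nu : quaternionic S ->
  ctr (quat S mu) *m quat S nu + ctr (quat S nu) *m quat S mu
    = ((mu == nu)%:R *+ 2)%:M.
Proof.
move=> SQ; rewrite /quat.
case: (unliftP ord0 mu) => [k ->|->]; case: (unliftP ord0 nu) => [l ->|->].
- have [-> e1 e2] := SQ k; have [-> e3 e4] := SQ l.
  rewrite !mulNmx -opprD (inj_eq lift_inj).
  have [<-|kl] := eqVneq k l.
    by rewrite e1 opprD opprK -raddfD mulr2n.
  have : (l == ordS k) || (k == ordS l).
    by case: k l kl {e1 e2 e3 e4} => -[|[|[|//]]] ? [[|[|[|//]]] ?].
  case/orP => /eqP E; subst.
    have := quaternion_prev SQ (ordS k); rewrite !ordS3 e2 => ->.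
    by rewrite addNr oppr0 mul0rn raddf0.
  have := quaternion_prev SQ (ordS l); rewrite !ordS3 e4 => ->.
  by rewrite addrN oppr0 mul0rn raddf0.
- by have [-> _ _] := SQ k; rewrite ctr1 mulmx1 mul1mx addNr mul0rn raddf0.
- by have [-> _ _] := SQ l; rewrite ctr1 mulmx1 mul1mx addrN mul0rn raddf0.
- by rewrite eqxx ctr1 mul1mx -raddfD mulr2n.
Qed.

(** This is the real span of 1 and the i sigma_k, described by entries so that closure under
    products is a direct computation. *)
Definition real_quaternion (M : 'M[C]_2) := M 1 1 = (M 0 0)^* /\ M 1 0 = - (M 0 1)^*.

Lemma real_quaternionM M N :
  real_quaternion M -> real_quaternion N -> real_quaternion (M *m N).
Proof.
move=> [M1 M2] [N1 N2].
have E (P Q : 'M[C]_2) i j : (P *m Q) i j = P i 0 * Q 0 j + P i 1 * Q 1 j.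
  rewrite mxE !big_ord_recl big_ord0 addr0.
  by have -> : lift ord0 (ord0 : 'I_1) = 1 by apply: val_inj.
rewrite /real_quaternion !E M1 M2 N1 N2 !rmorphD !rmorphM /= !(rmorphN, conjCK) /=.
by split; rewrite ?conjCK; ring.
Qed.

Lemma real_quaternion_ctr M : real_quaternion M -> real_quaternion (ctr M).
Proof.
move=> [M1 M2]; rewrite /real_quaternion !mxE M1 M2.
by split=> //; rewrite conjCK opprK.
Qed.

Lemma real_quaternionD M N :
  real_quaternion M -> real_quaternion N -> real_quaternion (M + N).
Proof.
by move=> [M1 M2] [N1 N2]; rewrite /real_quaternion !mxE M1 M2 N1 N2 !rmorphD opprD.
Qed.

Lemma real_quaternionZ c M :
  c \is Num.real -> real_quaternion M -> real_quaternion (c *: M).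
Proof.
move=> /CrealP cR [M1 M2].
by rewrite /real_quaternion !mxE M1 M2 !rmorphM /= cR mulrN.
Qed.

Lemma real_quaternion_tau mu : real_quaternion (tau mu).
Proof.
rewrite /quat; case: unliftP => [k _|_]; last first.
  by rewrite /real_quaternion !mxE /= ?(conjC1, conjC0, oppr0).
by case: k => -[|[|[|//]]] h; rewrite /real_quaternion !mxE /=
  ?(conjCi, rmorph0, rmorph1, oppr0, opprK, expr0, expr1, mul1r, mulN1r, mulr1n).
Qed.

Lemma self_adjoint_quaternion M :
  real_quaternion M -> ctr M = M -> M = (M 0 0)%:M.
Proof.
move=> [M1 M2] /matrixP MS.
have M01 : M 0 1 = 0.
  have := MS 0 1; rewrite !mxE M2 rmorphN /= conjCK => /eqP.
  by rewrite -subr_eq0 -opprD oppr_eq0 -mulr2n mulrn_eq0 => /eqP.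
have M00 : (M 0 0)^* = M 0 0 by have := MS 0 0; rewrite !mxE.
have o1 : lift ord0 (ord0 : 'I_1) = 1 by apply: val_inj.
apply/matrixP => -[[|[|//]] hi] [[|[|//]] hj]; rewrite !mxE /= ?mulr1n ?mulr0n.
- by congr (M _ _); apply: val_inj.
- by rewrite -M01; congr (M _ _); apply: val_inj.
- by rewrite -[RHS]oppr0 -[0]conjC0 -M01 -M2; congr (M _ _); apply: val_inj.
- by rewrite -M00 -M1; congr (M _ _); apply: val_inj.
Qed.

(* S_1 S_2 S_3 is a self-adjoint real quaternion of square 1, hence a sign. *)
Lemma quaternionic_up_to_sign (S : 'I_3 -> 'M[C]_2) :
  (forall k, real_quaternion (S k)) ->
  (forall k, ctr (S k) = - S k) -> (forall k, S k *m S k = - 1%:M) ->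
  (forall k l, k != l -> S k *m S l = - (S l *m S k)) ->
  exists2 p : C, p ^+ 2 = 1 /\ p^* = p & quaternionic (fun k => p *: S k).
Proof.
move=> SR Sa S2 Sc.
pose Pi k := S k *m S (ordS k) *m S (ordS (ordS k)).
have ordS_neq (k : 'I_3) : ordS k != k /\ ordS (ordS k) != k.
  by case: k => -[|[|[]]].
have PiC k : ctr (Pi k) = Pi k.
  rewrite /Pi !ctrM !Sa; set l := ordS k; set m := ordS l.
  have [lk mk] := ordS_neq k; have [ml _] := ordS_neq l.
  rewrite !(mulmxN, mulNmx) opprK mulmxA (Sc m l) // mulNmx opprK.
  by rewrite -(mulmxA (S l)) (Sc m k) // mulmxN mulmxA (Sc l k) // mulNmx opprK.
have PiE k : Pi k = (Pi k 0 0)%:M.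
  by apply: self_adjoint_quaternion => //; do 2!apply: real_quaternionM => //.
have unit k : ctr (S k) *m S k = 1%:M by rewrite Sa mulNmx S2 opprK.
have PiPi k : Pi k *m Pi k = 1%:M.
  rewrite -{1}PiC /Pi !ctrM -!mulmxA (mulmxA (ctr (S k))) unit mul1mx.
  by rewrite (mulmxA (ctr (S (ordS k)))) unit mul1mx unit.
(* Let (k, l, m) be cyclic and c the scalar of [Pi k]. Multiplying by S_k on the left gives - S_l
   S_m = c S_k, whence S_l S_m S_k is again c. *)
have PiS k : Pi (ordS k) = Pi k.
  have : S k *m Pi k = S k *m (Pi k 0 0)%:M by rewrite -PiE.
  rewrite {1}/Pi !mulmxA S2 mulNmx mul1mx mulNmx mul_mx_scalar => e.
  rewrite [LHS]/Pi ordS3 -[_ *m S (ordS (ordS k))]opprK e mulNmx -scalemxAl S2.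
  by rewrite -scalerN opprK scalemx1 -PiE.
pose p := Pi ord0 0 0.
have Pip k : Pi k = p%:M.
  rewrite /p -PiE -(PiS ord0) -(PiS (ordS ord0)).
  have [k0|[k1|k2]] : k = ord0 \/ k = ordS ord0 \/ k = ordS (ordS ord0).
    case: k => -[|[|[|//]]] hk; [left | right; left | right; right]; exact: val_inj.
  - by rewrite k0 !PiS.
  - by rewrite k1 !PiS.
  - by rewrite k2.
have p2 : p * p = 1.
  have := PiPi ord0; rewrite !Pip -scalar_mxM => /matrixP/(_ 0 0).
  by rewrite !mxE eqxx.
have pR : p^* = p by have /matrixP/(_ 0 0) := PiC ord0; rewrite mxE mxE.
exists p => // k; split.
- by rewrite ctrZ pR Sa scalerN.
- by rewrite -scalemxAl -scalemxAr scalerA p2 scale1r S2.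
- rewrite -scalemxAl -scalemxAr scalerA p2 scale1r.
  (* Since the last matrix squares to -1, this product is also - S_k S_(k+1). *)
  have : Pi k *m S (ordS (ordS k)) = p *: S (ordS (ordS k)).
    by rewrite Pip mul_scalar_mx.
  by rewrite {1}/Pi -mulmxA S2 mulmxN mulmx1 => <-; rewrite opprK.
Qed.

(** The rows of [O], read as quaternions T_mu, inherit the relations of [quat_clifford] by real
    orthogonality. Hence the T_0^* T_k are antihermitian, anticommute and square to -1, so
    [quaternionic_up_to_sign] applies. *)
Lemma orthogonal_frame (O : 'M[C]_4) : O \is a realmx -> O *m O^T = 1%:M ->
  exists P p S, [/\ ctr P *m P = 1%:M, quaternionic S, p^* = p :> C,
    \sum_nu O ord0 nu *: tau nu = P
    & forall k, \sum_nu O (lift ord0 k) nu *: tau nu = p *: (P *m S k)].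
Proof.
move=> /mxOverP OR O1; pose T mu := \sum_nu O mu nu *: tau nu.
have TR mu : real_quaternion (T mu).
  rewrite /T; elim/big_ind: _ => [|M N|nu _].
  - by rewrite /real_quaternion !mxE conjC0 oppr0.
  - exact: real_quaternionD.
  - by apply: real_quaternionZ; [exact: OR | exact: real_quaternion_tau].
have TC mu : ctr (T mu) = \sum_nu O mu nu *: ctr (tau nu).
  rewrite /T (big_morph _ (@ctrD R) (ctr0 R)); apply: eq_bigr => nu _.
  by rewrite ctrZ (CrealP (OR mu nu)).
have TT mu nu : ctr (T mu) *m T nu + ctr (T nu) *m T mu = ((mu == nu)%:R *+ 2)%:M.
  have E (a b : 'I_4) : ctr (T a) *m T b =
      \sum_i \sum_j (O a i * O b j) *: (ctr (tau i) *m tau j).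
    rewrite TC mulmx_suml; apply: eq_bigr => i _; rewrite mulmx_sumr.
    by apply: eq_bigr => j _; rewrite -scalemxAl -scalemxAr scalerA.
  rewrite !E [X in _ + X]exchange_big -big_split /=.
  transitivity (\sum_i (O mu i * O nu i) *: (2%:M : 'M[C]_2)).
    apply: eq_bigr => i _; rewrite -big_split /=.
    transitivity (\sum_j (O mu i * O nu j) *: (((i == j)%:R *+ 2)%:M : 'M[C]_2)).
      apply: eq_bigr => j _; rewrite [O nu j * _]mulrC -scalerDr quat_clifford //.
      exact: ipauli_quaternionic.
    rewrite (bigD1 i) //= eqxx big1 ?addr0 // => j ji.
    by rewrite eq_sym (negPf ji) mul0rn raddf0 scaler0.
  rewrite -scaler_suml; have /matrixP/(_ mu nu) := O1; rewrite !mxE => e.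
  have -> : \sum_i O mu i * O nu i = (mu == nu)%:R.
    by rewrite -e; apply: eq_bigr => j _; rewrite mxE.
  by rewrite scale_scalar_mx; congr (_%:M); rewrite mulr_natr.
have T1 mu : ctr (T mu) *m T mu = 1%:M.
  have := TT mu mu; rewrite eqxx => e.
  apply: (@scalerI _ _ (2 : C)); first by rewrite pnatr_eq0.
  by rewrite scalemx1 -e scaler_nat mulr2n.
have T1' mu : T mu *m ctr (T mu) = 1%:M by apply: mulmx1C.
have TTN mu nu : mu != nu -> ctr (T mu) *m T nu = - (ctr (T nu) *m T mu).
  move=> mn; apply/eqP; rewrite -addr_eq0 TT (negPf mn) mul0rn raddf0 //.
pose S k := ctr (T ord0) *m T (lift ord0 k).
have Sa k : ctr (S k) = - S k.
  by rewrite /S ctrM ctrK TTN // eq_sym neq_lift.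
(* Rewriting the first factor as - T_k^* T_0 brings T_0 next to its inverse T_0^*. *)
have SS k l : S k *m S l = - (ctr (T (lift ord0 k)) *m T (lift ord0 l)).
  rewrite -[S k]opprK -Sa mulNmx /S ctrM ctrK -mulmxA [T ord0 *m _]mulmxA.
  by rewrite T1' mul1mx.
have [|||p [p2 pR] pS] := @quaternionic_up_to_sign S _ Sa.
- by move=> k; apply: real_quaternionM => //; apply: real_quaternion_ctr.
- by move=> k; rewrite SS T1.
- by move=> k l kl; rewrite !SS TTN // (inj_eq lift_inj).
exists (T ord0), p, (fun k => p *: S k); split=> // k.
by rewrite -scalemxAr scalerA -expr2 p2 scale1r /S mulmxA T1' mul1mx.
Qed.
End Frames.

(** * Relations of the noncommutative spheres *)

Section Expi.
Variable R : realType.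
Implicit Types s t : R.

Lemma expiE t : expi t = (cos t)%:C%C + 'i%C * (sin t)%:C%C.
Proof. by rewrite /expi -[RHS]/(_ +i* _)%C; congr (_ +i* _)%C; rewrite /=; ring. Qed.

Lemma conj_expi t : (expi t)^* = (cos t)%:C%C - 'i%C * (sin t)%:C%C.
Proof.
rewrite -[LHS]/(cos t -i* sin t)%C -[RHS]/(_ +i* _)%C.
by congr (_ +i* _)%C; rewrite /=; ring.
Qed.

Lemma expi_conj_expi s t : expi s * (expi t)^* = expi (s - t).
Proof.
rewrite -[(expi t)^*]/(cos t -i* sin t)%C /expi cosB sinB.
by rewrite -[LHS]/(_ +i* _)%C; congr (_ +i* _)%C; rewrite /=; ring.
Qed.

Lemma norm_expi t : `|expi t| = 1.
Proof.
apply/eqP; rewrite -(@eqrXn2 _ 2) ?normr_ge0 ?ler01 // normCK expi_conj_expi.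
by rewrite subrr /expi cos0 sin0 expr1n.
Qed.

(** [acos] fixes the cosine and determines the sine up to sign, which selects the angle or its
    opposite. *)
Lemma expi_surj (u : R[i]) : `|u| = 1 -> exists t, u = expi t.
Proof.
case: u => a b; rewrite normc_def => -[/= /(congr1 (fun x => x ^+ 2))].
rewrite sqr_sqrtr ?addr_ge0 ?sqr_ge0 // expr1n => ab.
have a1 : -1 <= a <= 1.
  rewrite -ler_norml -(@ler_pXn2r _ 2) ?nnegrE ?expr1n // real_normK ?num_real //.
  by rewrite -ab lerDl sqr_ge0.
have ca : cos (acos a) = a by rewrite acosK // in_itv.
have sb : sin (acos a) ^+ 2 = b ^+ 2.
  by rewrite sin2cos2 ca -ab addrC addKr.
have /orP[/eqP e|/eqP e] : (sin (acos a) == b) || (sin (acos a) == - b).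
  by rewrite -eqf_sqr sb.
- by exists (acos a); rewrite /expi ca e.
- by exists (- acos a); rewrite /expi cosN sinN ca e opprK.
Qed.

End Expi.

(** * The matrix attached to hermitian coordinates and phases *)

Section Sphere.
Variables (R : realType) (A : starAlgType R[i]).
Local Notation C := R[i].
Local Notation tau := (quat (@ipauli R)).

(** Completeness of an orthogonal basis of the 2 by 2 matrices whose vectors have square norm 2,
    checked entry by entry. *)
Lemma pauli_complete i j k l :
  \sum_mu tau mu i j * (tau mu k l)^* = ((i == k) && (j == l))%:R *+ 2.
Proof.
have iM : 'i * 'i = -1 :> C by rewrite -expr2 sqrCi.
rewrite big_ord_recl /quat unlift_none; under eq_bigr do rewrite liftK.
rewrite !big_ord_recl big_ord0 !mxE /=.
case: i j k l => -[|[|[|//]]] ? [[|[|[|//]]] ?] [[|[|[|//]]] ?] [[|[|[|//]]] ?] //=;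
rewrite ?(expr0, expr1) ?(conjC1, conjC0, conjCi, rmorphM, rmorphN1) /= ?(conjCi, conjC1);
 by rewrite ?(mul1r, mulr1, mul0r, mulr0, mulN1r, mulrN1, mulrN, mulNr, add0r,
   addr0, oppr0, opprK, iM, mulr0n, mulr2n, addrN, addNr, mulNrn).
Qed.

Lemma quaternion_decomposition (M : 'M[A]_2) :
  exists y : 'I_4 -> A, M = \sum_mu kron (tau mu) (y mu).
Proof.
exists (fun mu => 2^-1 *: slice (@ipauli R) mu M); apply/matrixP => i j.
rewrite summxE /slice; apply/esym.
transitivity (\sum_k \sum_l (((i == k) && (j == l))%:R : C) *: M k l); last first.
  rewrite (bigD1 i) //= [X in _ + X]big1 ?addr0 => [|k ki]; last first.
    by rewrite big1 // => l _; rewrite [i == k]eq_sym (negPf ki) scale0r.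
  rewrite (bigD1 j) //= !eqxx scale1r big1 ?addr0 // => l lj.
  by rewrite [j == l]eq_sym (negPf lj) scale0r.
under eq_bigr => mu _.
  rewrite mxE scalerA scaler_sumr.
  under eq_bigr => k _ do rewrite scaler_sumr.
  over.
rewrite exchange_big; apply: eq_bigr => k _.
rewrite exchange_big; apply: eq_bigr => l _ /=.
transitivity (\sum_mu (2^-1 * (tau mu i j * (tau mu k l)^*)) *: M k l).
  by apply: eq_bigr => mu _; rewrite scalerA; congr (_ *: _); ring.
rewrite -scaler_suml -mulr_sumr pauli_complete; congr (_ *: _).
by rewrite -[X in _ * X]mulr_natr mulrA mulrAC mulVf ?mul1r ?pnatr_eq0.
Qed.

Variable S : 'I_3 -> 'M[C]_2.
Hypothesis SQ : quaternionic S.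

Lemma eq_qform a (y w : 'I_3 -> A) : y =1 w -> qform S a y = qform S a w.
Proof. by move=> yw; congr (_ + _); apply: eq_bigr => k _; rewrite yw. Qed.

Variables (x : 'I_4 -> A) (phi : 'I_3 -> R).
Hypothesis x_herm : forall mu, star (x mu) = x mu.

Definition sphere_matrix : 'M[A]_2 :=
  qform S (x ord0) (fun k => expi (phi k) *: x (lift ord0 k)).

Lemma adjoint_sphere_matrix : adjoint sphere_matrix =
  qform S (x ord0) (fun k => - ((expi (phi k))^* *: x (lift ord0 k))).
Proof.
rewrite adjoint_qform // x_herm; apply: eq_qform => k.
by rewrite starZ x_herm.
Qed.

(** Here [c], [s], [d], [e] stand for cos(phi_k), i sin(phi_k), cos(phi_l - phi_m), i sin(phi_l -
    phi_m), and [p], [q], [r], [t] for x^k x^0, x^0 x^k, x^l x^m, x^m x^l. The right side is then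
    [relation_lm] minus [relation_0k]. *)
Lemma relations_regroup (V : lmodType C) (c s d e : C) (p q r t : V) :
  (c + s) *: p - (c - s) *: q + ((d + e) *: r - (d - e) *: t) =
  (d *: (r - t) + s *: (q + p)) - (c *: (q - p) - e *: (r + t)).
Proof.
rewrite !(scalerDl, scalerDr, scalerN, scaleNr, opprD, opprK) !addrA.
by rewrite [LHS](ACl (5*7*4*2*3*1*6*8)).
Qed.

Lemma relations_regroup_sum (V : lmodType C) (c s d e : C) (p q r t : V) :
  (c + s) *: q - (c - s) *: p + ((d - e) *: r - (d + e) *: t) =
  (d *: (r - t) + s *: (q + p)) + (c *: (q - p) - e *: (r + t)).
Proof.
rewrite !(scalerDl, scalerDr, scalerN, scaleNr, opprD, opprK) !addrA.
by rewrite [LHS](ACl (5*7*2*4*1*3*6*8)).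
Qed.

Lemma expi_opp (t : R) : expi (- t) = (cos t)%:C%C - 'i%C * (sin t)%:C%C.
Proof. by rewrite -conj_expi /expi cosN sinN. Qed.

Let S0 := \sum_(mu < 4) x mu ^+ 2.

Let normE k : expi (phi k) * (expi (phi k))^* = 1.
Proof. by rewrite expi_conj_expi subrr /expi cos0 sin0. Qed.

Lemma sphere_matrix_adjoint : sphere_matrix *m adjoint sphere_matrix =
  qform S S0 (fun k => relation_lm x phi k - relation_0k x phi k).
Proof.
rewrite adjoint_sphere_matrix qformM //; congr (kron _ _ + _).
  rewrite /S0 [RHS]big_ord_recl -sumrN; congr (_ + _); apply: eq_bigr => k _.
  by rewrite mulrN opprK -star_scalerAl -star_scalerAr scalerA normE scale1r.
apply: eq_bigr => k _; congr kron; rewrite /relation_lm /relation_0k.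
set l := ordS k; set m := ordS l.
rewrite !mulrN opprD !opprK -!star_scalerAl -!star_scalerAr !scalerA.
rewrite !expi_conj_expi -(opprB (phi l)) expi_opp conj_expi !expiE.
rewrite [- _ + _]addrC mulNr scaleNr opprK; exact: relations_regroup.
Qed.

Lemma adjoint_sphere_matrixM : adjoint sphere_matrix *m sphere_matrix =
  qform S S0 (fun k => relation_lm x phi k + relation_0k x phi k).
Proof.
rewrite adjoint_sphere_matrix qformM //; congr (kron _ _ + _).
  rewrite /S0 [RHS]big_ord_recl -sumrN; congr (_ + _); apply: eq_bigr => k _.
  by rewrite mulNr opprK -star_scalerAl -star_scalerAr scalerA mulrC normE scale1r.
apply: eq_bigr => k _; congr kron; rewrite /relation_lm /relation_0k.
set l := ordS k; set m := ordS l.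
rewrite !mulNr opprD !opprK -!star_scalerAl -!star_scalerAr !scalerA.
rewrite ![_^* * _]mulrC !expi_conj_expi -(opprB (phi l)) expi_opp conj_expi !expiE.
rewrite scaleNr opprK; exact: relations_regroup_sum.
Qed.
End Sphere.

(** * Condition (II) in terms of bilinear maps *)

Lemma tensor_linearl (C : numClosedFieldType) (V W : lmodType C) (w : W) :
  linear (fun v : V => tensor v w).
Proof.
move=> c v v'; rewrite /tensor -lprojZ -lprojD; apply/lproj_eq/span_gen.
by left; exists c, v, v', w.
Qed.

Lemma tensor_linearr (C : numClosedFieldType) (V W : lmodType C) (v : V) :
  linear (fun w : W => tensor v w).
Proof.
move=> c w w'; rewrite /tensor -lprojZ -lprojD; apply/lproj_eq/span_gen.
by right; exists c, v, w, w'.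
Qed.

(* Stated over an abstract module: unifying the module structures of a tensor
   product over R[i] is prohibitively slow. *)
Lemma tensor_antisymmetrized (C : numClosedFieldType) (V : lmodType C) n
    (a b : 'I_n -> 'I_n -> V) :
  \sum_i \sum_j (tensor (a i j) (b j i) - tensor (b i j) (a j i)) = 0
    :> tensor_product V V <->
  (forall (X : lmodType C) (B : V -> V -> X),
     (forall t, linear (B^~ t)) -> (forall v, linear (B v)) ->
     \sum_i \sum_j (B (a i j) (b j i) - B (b i j) (a j i)) = 0).
Proof.
split=> [T0 X B Bl Br|H]; last first.
  exact: (H _ _ (@tensor_linearl C V V) (@tensor_linearr C V V)).
have [F Flin FE] := tensor_lift Bl Br.
have FD : {morph F : x y / x + y}.
  by move=> x y; rewrite -[x in F (x + y)]scale1r Flin scale1r.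
have F0 : F 0 = 0 by rewrite -(subrr 0) (GRing.zmod_morphism_linear Flin) subrr.
have := congr1 F T0; rewrite F0 (big_morph F FD F0) => e; rewrite -[RHS]e.
apply: eq_bigr => i _; rewrite (big_morph F FD F0); apply: eq_bigr => j _.
by rewrite (GRing.zmod_morphism_linear Flin) !FE.
Qed.

Section CondII.
Variables (R : realType) (A : starAlgType R[i]).
Lemma condIIP (M : 'M[A]_2) : condII M <->
  (forall (X : lmodType R[i]) (B : A -> A -> X),
     (forall t, linear (B^~ t)) -> (forall v, linear (B v)) ->
     \sum_i \sum_j (B (M i j) (adjoint M j i) - B (adjoint M i j) (M j i)) = 0).
Proof. exact: (@tensor_antisymmetrized R[i] A 2 M (adjoint M)). Qed.
End CondII.

(** * From the relations to the conditions *)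

Definition sphere_relations (R : realType) (A : starAlgType R[i]) (x : 'I_4 -> A)
    (phi : 'I_3 -> R) :=
  forall k, relation_0k x phi k = 0 /\ relation_lm x phi k = 0.

Lemma star_proj_relation (C : numClosedFieldType) (A : starAlgType C) (S : set A) s :
  S s -> star_proj S s = 0.
Proof.
move=> Ss; rewrite -(star_morph0 (star_proj_morphism S)); apply/star_proj_eq.
rewrite subr0; apply: span_gen; exists 1, s, 1.
by rewrite mulr1 mul1r; split=> //; left.
Qed.

Section Relations.
Variables (R : realType) (A : starAlgType R[i]).
Local Notation C := R[i].
Implicit Types (x : 'I_4 -> A) (phi psi : 'I_3 -> R).

(** By the subtraction formulas, the relations involve the angles only through their cosines and
    sines. *)
Lemma sphere_relations_expi x phi psi : (forall k, expi (phi k) = expi (psi k)) ->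
  sphere_relations x phi -> sphere_relations x psi.
Proof.
move=> e xphi k; have ce j : cos (phi j) = cos (psi j) by have [] := e j.
have se j : sin (phi j) = sin (psi j) by have [] := e j.
by have := xphi k; rewrite /relation_0k /relation_lm !(cosB, sinB) !ce !se.
Qed.

Lemma relation_0k_morph (B : starAlgType R[i]) (f : A -> B) x phi k :
  star_morphism f -> f (relation_0k x phi k) = relation_0k (f \o x) phi k.
Proof.
move=> fM; rewrite /relation_0k (star_morphB fM) !(star_morphZ fM).
by rewrite /comm /acomm (star_morphB fM) (star_morphD fM) !(star_morphM fM).
Qed.

Lemma relation_lm_morph (B : starAlgType R[i]) (f : A -> B) x phi k :
  star_morphism f -> f (relation_lm x phi k) = relation_lm (f \o x) phi k.
Proof.
move=> fM; rewrite /relation_lm (star_morphB fM) !(star_morphZ fM).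
by rewrite /comm /acomm (star_morphB fM) (star_morphD fM) !(star_morphM fM).
Qed.

Lemma sphere_relations_morph (B : starAlgType R[i]) (f : A -> B) x phi :
  star_morphism f -> sphere_relations x phi -> sphere_relations (f \o x) phi.
Proof.
move=> fM xphi k; have [e1 e2] := xphi k.
by rewrite -(relation_0k_morph _ _ _ fM) -(relation_lm_morph _ _ _ fM) e1 e2 (star_morph0 fM).
Qed.

Lemma star_proj_sphere_relations x u phi : (forall k, u k = expi (phi k)) ->
  sphere_relations (fun mu => star_proj (relations x u) (x mu)) phi.
Proof.
move=> uE k; have fM := star_proj_morphism (relations x u).
by rewrite -(relation_0k_morph _ _ _ fM) -(relation_lm_morph _ _ _ fM);
  split; apply: star_proj_relation; exists phi => //; exists k; auto.
Qed.

Lemma sphere_sum_morph (B : starAlgType R[i]) (f : A -> B) x :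
  star_morphism f -> f (\sum_mu x mu ^+ 2 - 1) = \sum_mu f (x mu) ^+ 2 - 1.
Proof.
move=> fM; rewrite (star_morphB fM) (star_morph_sum fM) (star_morph1 fM).
by congr (_ - _); apply: eq_bigr => mu _; rewrite !expr2 (star_morphM fM).
Qed.

Lemma star_proj_sphere_sum (S : set A) x : S (\sum_mu x mu ^+ 2 - 1) ->
  \sum_mu (star_proj S (x mu) : star_quot S) ^+ 2 = 1.
Proof.
move=> Sx; apply/eqP; rewrite -subr_eq0.
by rewrite -(sphere_sum_morph _ (star_proj_morphism S)) star_proj_relation.
Qed.

Lemma star_proj_generated (S : set A) x : star_generated (range x) ->
  star_generated (range (fun mu => star_proj S (x mu))).
Proof.
move=> genx; have := star_generated_image (star_proj_morphism S)
  (@star_proj_surj _ _ S) genx.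
by rewrite image_comp.
Qed.

Lemma star_proj_herm (S : set A) x mu : star (x mu) = x mu ->
  star (star_proj S (x mu) : star_quot S) = star_proj S (x mu).
Proof. by move=> xh; rewrite -(star_morph_star (star_proj_morphism S)) xh. Qed.

(** All lifts [phi] of [u] have to be considered because [relations] collects the relations of every
    lift. *)
Lemma sphere_quotient_universal (B : starAlgType R[i]) (f : A -> B) x u :
  star_morphism f -> (forall phi, (forall k, u k = expi (phi k)) ->
    sphere_relations (f \o x) phi) ->
  exists2 g : star_quot (relations x u) -> B, star_morphism g &
    forall a, g (star_proj (relations x u) a) = f a.
Proof.
move=> fM rel; apply: star_quot_lift => // s [phi uE [k sE]].
have [r0 rlm] := rel phi uE k.
by case: sE => ->; rewrite ?(relation_0k_morph _ _ _ fM) ?(relation_lm_morph _ _ _ fM).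
Qed.

Lemma sphere_sum_quotient_universal (B : starAlgType R[i]) (f : A -> B) x :
  let S := [set \sum_(mu < 4) x mu ^+ 2 - 1] in
  star_morphism f -> \sum_mu f (x mu) ^+ 2 = 1 ->
  exists2 g : star_quot S -> B, star_morphism g & forall a, g (star_proj S a) = f a.
Proof.
move=> S fM x1; apply: star_quot_lift => // s ->.
by rewrite sphere_sum_morph // x1 subrr.
Qed.

Variable S : 'I_3 -> 'M[C]_2.
Hypothesis SQ : quaternionic S.

(** Comparing components with [qform_inj], both products are scalar exactly when the sum and the
    difference of the two relations vanish at each index; since 2 is invertible, both relations then
    vanish. *)
Lemma sphere_matrixP x phi a : (forall mu, star (x mu) = x mu) ->
  (adjoint (sphere_matrix S x phi) *m sphere_matrix S x phi = a%:M /\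
   sphere_matrix S x phi *m adjoint (sphere_matrix S x phi) = a%:M) <->
  (\sum_mu x mu ^+ 2 = a /\ sphere_relations x phi).
Proof.
move=> xh; rewrite sphere_matrix_adjoint // adjoint_sphere_matrixM //.
have aE : a%:M = qform S a (fun=> 0).
  by rewrite /qform kron_scalar big1 ?addr0 // => k _; rewrite kron0.
rewrite aE; split=> [[/(qform_inj SQ)[-> e1] /(qform_inj SQ)[_ e2]]|[-> e]].
  split=> // k; have := e1 k; have /eqP := e2 k; rewrite subr_eq0 => /eqP ->.
  rewrite -mulr2n -scaler_nat => /eqP; rewrite scaler_eq0 pnatr_eq0 => /eqP->.
  by [].
by split; apply: eq_qform => k; have [-> ->] := e k; rewrite ?subr0 ?addr0.
Qed.

Definition sphere_phase phi (mu : 'I_4) : C :=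
  if unlift ord0 mu is Some k then expi (phi k) else 1.

Lemma sphere_matrixE x phi : sphere_matrix S x phi =
  \sum_mu kron (quat S mu) (sphere_phase phi mu *: x mu).
Proof.
rewrite -qformE /sphere_phase unlift_none scale1r; apply: eq_qform => k /=.
by rewrite liftK.
Qed.

Lemma sphere_phase_conj phi mu : sphere_phase phi mu * (sphere_phase phi mu)^* = 1.
Proof.
rewrite /sphere_phase; case: unliftP => [k _|_]; last by rewrite conjC1 mulr1.
by rewrite expi_conj_expi subrr /expi cos0 sin0.
Qed.

Lemma frobenius_antisymmetrized (X : lmodType C) (B : A -> A -> X) (y : 'I_4 -> A) M :
  (forall t, linear (B^~ t)) -> (forall v, linear (B v)) ->
  M = \sum_mu kron (quat S mu) (y mu) ->
  \sum_i \sum_j (B (M i j) (adjoint M j i) - B (adjoint M i j) (M j i)) =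
  2 *: (\sum_mu B (y mu) (star (y mu)) - \sum_mu B (star (y mu)) (y mu)).
Proof.
move=> Bl Br ME; under eq_bigr do rewrite sumrB.
rewrite sumrB (frobenius_bilinear SQ Bl Br ME) [X in _ - X]exchange_big /=.
by rewrite (frobenius_bilinear SQ (B := fun a b => B b a) Br Bl ME) scalerBr.
Qed.

(** Each component is a phase times a hermitian element, and the phase cancels against its conjugate
    in the adjoint. *)
Lemma condII_sphere_matrix x phi : (forall mu, star (x mu) = x mu) ->
  condII (sphere_matrix S x phi).
Proof.
move=> xh; apply/condIIP => X B Bl Br.
rewrite (frobenius_antisymmetrized Bl Br (sphere_matrixE x phi)) -sumrB.
rewrite big1 ?scaler0 // => mu _; rewrite !starZ xh.
have E (c d : C) : B (c *: x mu) (d *: x mu) = (c * d) *: B (x mu) (x mu).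
  rewrite -scalerA -[d *: B _ _](GRing.scalable_linear (Br _)).
  exact: (GRing.scalable_linear (Bl _)).
by rewrite !E mulrC subrr.
Qed.

Lemma sphere_matrix_generated x phi :
  star_generated (range x) -> star_generated (entries (sphere_matrix S x phi)).
Proof.
move=> genx P PA UP; apply: genx => // _ [mu _ <-].
have yP : P (slice S mu (sphere_matrix S x phi)).
  apply: star_subalgebra_sum => // i; apply: star_subalgebra_sum => // j.
  by apply: star_subalgebraZ => //; apply: UP; exists i, j.
rewrite sphere_matrixE slice_quat // in yP.
(* The slice is twice the phase times [x mu]; this scalar undoes both factors. *)
have := star_subalgebraZ PA (2^-1 * (sphere_phase phi mu)^*) yP.
rewrite !scalerA; suff -> : 2^-1 * (sphere_phase phi mu)^* * 2 * sphere_phase phi mu = 1.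
  by rewrite scale1r.
by rewrite -mulrA mulrACA mulVf ?pnatr_eq0 // mul1r mulrC sphere_phase_conj.
Qed.

Lemma relations_imply_I_II x phi :
  (forall mu, star (x mu) = x mu) -> star_generated (range x) ->
  sphere_relations x phi -> satisfies_I_II A.
Proof.
move=> xh genx rel; exists (sphere_matrix S x phi).
split; last exact: condII_sphere_matrix.
split; first exact: sphere_matrix_generated.
by exists (\sum_mu x mu ^+ 2); apply/sphere_matrixP.
Qed.

Lemma relations_imply_I1_II x phi :
  (forall mu, star (x mu) = x mu) -> star_generated (range x) ->
  sphere_relations x phi -> \sum_mu x mu ^+ 2 = 1 -> satisfies_I1_II A.
Proof.
move=> xh genx rel x1; exists (sphere_matrix S x phi).
split; last exact: condII_sphere_matrix.
split; last exact: sphere_matrix_generated.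
exact/sphere_matrixP.
Qed.
End Relations.

(** * From the conditions to the relations *)

Section NormalForm.
Variables (R : realType) (A : starAlgType R[i]).
Local Notation C := R[i].
Local Notation tau := (quat (@ipauli R)).

(** Condition (II) is tested on the bilinear map sending (a, b) to f(a) b. *)
Lemma condII_tensor_symmetric (y : 'I_4 -> A) :
  condII (\sum_mu kron (tau mu) (y mu)) -> tensor_symmetric y.
Proof.
move=> /condIIP MB f.
have Bl (t : A) : linear (fun a : A => f a *: t).
  by move=> c u v; rewrite linearP scalerDl scalerA.
have Br (v : A) : linear (fun a : A => f v *: a).
  by move=> c u t; rewrite scalerDr !scalerA mulrC.
have := MB _ (fun a b : A => f a *: b) Bl Br.
rewrite (frobenius_antisymmetrized (ipauli_quaternionic R) Bl Br erefl).
by move/eqP; rewrite scaler_eq0 pnatr_eq0 subr_eq0 => /eqP.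
Qed.

(** Diagonalization turns [U] into the sum of the T_mu ⊗ e_mu x_mu, with T_mu the rows of [O] as
    quaternions. The phase e_0 moves into [P], leaving the relative phases e_k e_0^*, and the real
    factor [p] moves into the x_k. *)
Lemma condII_normal_form (U : 'M[A]_2) : condII U ->
  exists (P : 'M[C]_2) S x phi, [/\ ctr P *m P = 1%:M, quaternionic S,
    forall mu, star (x mu) = x mu & U = kron P 1 *m sphere_matrix S x phi].
Proof.
have [z ->] := quaternion_decomposition U.
move=> /condII_tensor_symmetric/hermitian_phases[O [e [x [OR O1 e1 xh Oz]]]].
have [P [p [S [P1 SQ pR T0 Tk]]]] := orthogonal_frame OR O1.
have ee mu : e mu * (e mu)^* = 1 by rewrite -normCK e1 expr1n.
have [phi phiE] : exists phi : 'I_3 -> R, forall k,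
    e (lift ord0 k) * (e ord0)^* = expi (phi k).
  have /choice[phi phiE] : forall k : 'I_3, exists t : R,
      e (lift ord0 k) * (e ord0)^* = expi t.
    by move=> k; apply: expi_surj; rewrite normrM norm_conjC !e1 mulr1.
  by exists phi.
exists (e ord0 *: P), S, (fun mu => if unlift ord0 mu is Some _ then p *: x mu else x mu), phi.
split=> //.
- by rewrite ctrZ -scalemxAl -scalemxAr scalerA mulrC ee scale1r.
- by move=> mu; case: unliftP => [k _|_]; rewrite ?starZ xh ?pR.
have zE nu : z nu = \sum_mu O mu nu *: (e mu *: x mu).
  rewrite -[LHS](mxact1 z) -(mulmx1C O1) mxactM; apply: eq_bigr => mu _.
  by rewrite mxE Oz.
transitivity (\sum_mu kron (\sum_nu O mu nu *: tau nu) (e mu *: x mu)).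
  under eq_bigr => nu _ do rewrite zE kron_sumr.
  rewrite exchange_big; apply: eq_bigr => mu _.
  by rewrite kron_suml; apply: eq_bigr => nu _; rewrite kronZ.
rewrite big_ord_recl T0 /sphere_matrix /qform mulmxDr unlift_none kronM mulmx1 mul1r kronZ.
congr (_ + _); rewrite mulmx_sumr; apply: eq_bigr => k _.
rewrite Tk liftK kronM mul1r -scalemxAl !kronZ; congr kron.
rewrite !scalerA -phiE; congr (_ *: _).
rewrite [RHS](_ : _ = e ord0 * (e ord0)^* * (e (lift ord0 k) * p)); last by ring.
by rewrite ee; ring.
Qed.

(** Multiplying [U] on the left by the adjoint of the scalar unitary [P] gives the sphere matrix and
    keeps both products equal to [a%:M], which commutes with scalar matrices. The entries of [U] are
    combinations of the [x mu], so these generate. *)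
Lemma conditions_imply_relations (U : 'M[A]_2) a :
  star_generated (entries U) -> condII U ->
  adjoint U *m U = a%:M -> U *m adjoint U = a%:M ->
  exists x phi, [/\ forall mu, star (x mu) = x mu, star_generated (range x),
    sphere_relations x phi & \sum_mu x mu ^+ 2 = a].
Proof.
move=> genU /condII_normal_form[P [S [x [phi [P1 SQ xh UE]]]]] U1 U2.
have P1' : P *m ctr P = 1%:M by apply: mulmx1C.
have k1 : kron 1%:M 1 = 1%:M :> 'M[A]_2 by rewrite kron_scalar.
have ME : sphere_matrix S x phi = kron (ctr P) 1 *m U.
  by rewrite UE mulmxA kronM P1 mulr1 k1 mul1mx.
have [e rel] : \sum_mu x mu ^+ 2 = a /\ sphere_relations x phi.
  apply/(sphere_matrixP SQ _ _ xh); rewrite ME adjointM adjoint_kron ctrK star1.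
  split.
    by rewrite mulmxA -[_ *m kron P 1 *m _]mulmxA kronM P1' mulr1 k1 mulmx1.
  rewrite mulmxA -[_ *m U *m _]mulmxA U2 -!kron_scalar !kronM.
  by rewrite mulmx1 P1 mul1r mulr1.
exists x, phi; split=> //.
apply: star_generated_sub genU _ => Q QA xQ _ [i [j ->]].
rewrite UE sphere_matrixE mxE; apply: star_subalgebra_sum => // k.
case: (QA) => _ _ QM _; apply: QM.
  by rewrite mxE; apply: star_subalgebraZ => //; case: QA.
rewrite summxE; apply: star_subalgebra_sum => // mu; rewrite mxE.
by do 2!apply: star_subalgebraZ => //; apply: xQ; exists mu.
Qed.
End NormalForm.

(** * Universal properties of the presented algebras *)

Section Algebras.
Variables (R : realType) (u : 'I_3 -> R[i]).

Lemma Au_gen_herm mu : star (Au_gen u mu) = Au_gen u mu.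
Proof. exact: star_proj_herm (star_herm_gen _ _). Qed.

Lemma Au_gen_relations phi : (forall k, u k = expi (phi k)) ->
  sphere_relations (Au_gen u) phi.
Proof. exact: star_proj_sphere_relations. Qed.

Lemma Au_gen_generated : star_generated (range (Au_gen u)).
Proof. exact: star_proj_generated (@free_herm_generated R[i] 'I_4). Qed.

Lemma Au_universal (B : starAlgType R[i]) (x : 'I_4 -> B) :
  (forall mu, star (x mu) = x mu) ->
  (forall phi, (forall k, u k = expi (phi k)) -> sphere_relations x phi) ->
  exists2 f : Au u -> B, star_morphism f & forall mu, f (Au_gen u mu) = x mu.
Proof.
move=> xh rel; have gM := free_eval_morphism xh.
have gE : free_eval x \o @herm_gen R[i] 'I_4 = x.
  by apply/funext => mu; apply: free_eval_gen.
have [|f fM fE] := @sphere_quotient_universal _ _ _ _ (@herm_gen R[i] 'I_4) u gM.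
  by rewrite gE.
by exists f => // mu; rewrite -[RHS](free_eval_gen x); apply: fE.
Qed.

Lemma Au1_universal (B : starAlgType R[i]) (x : 'I_4 -> B) :
  (forall mu, star (x mu) = x mu) ->
  (forall phi, (forall k, u k = expi (phi k)) -> sphere_relations x phi) ->
  \sum_mu x mu ^+ 2 = 1 ->
  exists2 f : Au1 u -> B, star_morphism f &
    forall mu, f (star_proj _ (Au_gen u mu)) = x mu.
Proof.
move=> xh rel x1; have [g gM gx] := Au_universal xh rel.
have [|f fM fE] := @sphere_sum_quotient_universal _ _ _ _ (Au_gen u) gM.
  by rewrite (eq_bigr (fun mu => x mu ^+ 2)) // => mu _; rewrite gx.
by exists f => // mu; rewrite -gx; apply: fE.
Qed.

End Algebras.

(** The range is a star subalgebra, hence everything once it contains generators. *)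
Lemma star_surjective (C : numClosedFieldType) (A B : starAlgType C) (f : A -> B)
    (S : set B) :
  star_morphism f -> star_generated S -> S `<=` range f -> forall y, exists x, f x = y.
Proof.
move=> fM genS Sf y.
by have [x _ <-] := genS _ (star_image_subalgebra fM) Sf y; exists x.
Qed.

Theorem theorem1 (R : realType) :
  ((forall u : 'I_3 -> R[i], in_torus3 u -> satisfies_I_II (Au u)) /\
   (forall A : starAlgType R[i], satisfies_I_II A ->
      exists2 u : 'I_3 -> R[i], in_torus3 u & is_star_quotient_of A (Au u))) /\
  ((forall u : 'I_3 -> R[i], in_torus3 u -> satisfies_I1_II (Au1 u)) /\
   (forall A : starAlgType R[i], satisfies_I1_II A ->
      exists2 u : 'I_3 -> R[i], in_torus3 u & is_star_quotient_of A (Au1 u))).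
Proof.
have lift (u : 'I_3 -> R[i]) : in_torus3 u -> exists phi, forall k, u k = expi (phi k).
  move=> u1; have /choice[phi uE] : forall k, exists t, u k = expi t.
    by move=> k; apply: expi_surj.
  by exists phi.
(* The conditions provide the relations for one choice of angles, whereas the universal properties
   ask for all choices with the same exponentials. *)
have rel_lift (A : starAlgType R[i]) (x : 'I_4 -> A) phi :
    sphere_relations x phi -> forall psi : 'I_3 -> R,
    (forall k, expi (phi k) = expi (psi k)) -> sphere_relations x psi.
  by move=> rel psi e; apply: sphere_relations_expi rel.
split; split.
- move=> u /lift[phi uE].
  exact: (relations_imply_I_II (ipauli_quaternionic R) (@Au_gen_herm R u)
    (@Au_gen_generated R u) (Au_gen_relations uE)).
- move=> A [U [[genU [a [U1 U2]]] II]].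
  have [x [phi [xh genx rel xa]]] := conditions_imply_relations genU II U1 U2.
  exists (fun k => expi (phi k)); first by move=> k; apply: norm_expi.
  have [f fM fx] := Au_universal xh (rel_lift _ _ _ rel).
  exists f => //; apply: star_surjective fM genx _ => _ [mu _ <-].
  by exists (Au_gen _ mu).
- move=> u /lift[phi uE].
  pose S := [set \sum_(mu < 4) Au_gen u mu ^+ 2 - 1].
  have qM := star_proj_morphism S; pose x mu : Au1 u := star_proj S (Au_gen u mu).
  have xh mu : star (x mu) = x mu by apply/star_proj_herm/Au_gen_herm.
  have x1 : \sum_mu x mu ^+ 2 = 1 by apply: star_proj_sphere_sum.
  have genx : star_generated (range x).
    exact: (@star_proj_generated R _ S _ (@Au_gen_generated R u)).
  have rel := sphere_relations_morph qM (Au_gen_relations uE).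
  exact: (relations_imply_I1_II (ipauli_quaternionic R) xh genx rel x1).
- move=> A [U [[[U1 U2] genU] II]].
  have [x [phi [xh genx rel xa]]] := conditions_imply_relations genU II U1 U2.
  exists (fun k => expi (phi k)); first by move=> k; apply: norm_expi.
  have [f fM fx] := Au1_universal xh (rel_lift _ _ _ rel) xa.
  exists f => //; apply: star_surjective fM genx _ => _ [mu _ <-].
  by exists (star_proj _ (Au_gen _ mu)).
Qed.
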